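(* Let $n$ be a positive integer. If $A$ is a separable and weakly projective $C^{*}$-algebra, then $\mathbf{M}_{n}(A)$ is weakly projective.
   Context: A separable $C^{*}$-algebra $A$ is weakly projective if, for every $*$-homomorphism $\varphi:A\rightarrow C$ and every surjective $*$-homomorphism $\rho:B\rightarrow C$ of arbitrary (not necessarily unital) $C^{*}$-algebras, there is a sequence $\varphi_{n}:A\rightarrow B$ of $*$-homomorphisms so that $\rho\circ\varphi_{n}\rightarrow\varphi$, meaning $\lim_{n\to\infty}\|\rho(\varphi_{n}(a))-\varphi(a)\|=0$ for each $a\in A$. $\mathbf{M}_{n}(A)$ is the $C^{*}$-algebra of $n\times n$ matrices over $A$. *)

(* Defs.v *)
From HB Require Import structures.
From mathcomp Require Import all_boot all_order all_algebra.
From mathcomp Require Import all_classical all_reals all_analysis.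
From mathcomp.real_closed Require Import complex.

Set Implicit Arguments.
Unset Strict Implicit.
Unset Printing Implicit Defensive.

Import Order.TTheory GRing.Theory Num.Theory.
Import numFieldNormedType.Exports.

Local Open Scope classical_set_scope.
Local Open Scope ring_scope.
Local Open Scope complex_scope.

Declare Scope star_scope.
Delimit Scope star_scope with star.
Local Open Scope star_scope.

(* Complex *-algebras, without any unit: MathComp's ring structures all have
   one, so the product is introduced here on top of a C-module. *)
HB.mixin Record Lmodule_isStarAlgebra (R : realType) A
    of GRing.Lmodule R[i] A := {
  smul : A -> A -> A;
  star : A -> A;
  smulA : associative smul;
  smulDl : left_distributive smul +%R;
  smulDr : right_distributive smul +%R;
  smulZl : forall (c : R[i]) x y, smul (c *: x) y = c *: smul x y;
  smulZr : forall (c : R[i]) x y, smul x (c *: y) = c *: smul x y;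
  starK : involutive star;
  starD : {morph star : x y / x + y};
  starZ : forall (c : R[i]) x, star (c *: x) = c^* *: star x;
  starM : forall x y, star (smul x y) = smul (star y) (star x)
}.

#[short(type="starAlgType")]
HB.structure Definition StarAlgebra (R : realType) :=
  {A of GRing.Lmodule R[i] A & Lmodule_isStarAlgebra R A}.

Notation "x ** y" := (smul x y) (at level 40, left associativity) : star_scope.

Definition star_hom (R : realType) (A B : starAlgType R) (f : A -> B) : Prop :=
  [/\ linear f, {morph f : x y / x ** y} & {morph f : x / star x}].

(* A C*-algebra is a *-algebra [A] with a norm [N] such that [cstar_norm N].
   Norms are kept as explicit real-valued functions so that one may speak of
   the norm of M_n(A) without having to bundle the proof that it is a C*-norm. *)

Definition cauchy_for (R : realType) (A : zmodType) (N : A -> R)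
    (u : nat -> A) : Prop :=
  forall e : R, 0 < e -> exists K : nat,
    forall p q : nat, (K <= p)%N -> (K <= q)%N -> N (u p - u q) < e.

Definition cvg_for (R : realType) (A : zmodType) (N : A -> R)
    (u : nat -> A) (l : A) : Prop :=
  N (u k - l) @[k --> \oo] --> (0 : R).

Record cstar_norm (R : realType) (A : starAlgType R) (N : A -> R) : Prop := {
  cnorm_triangle : forall x y, N (x + y) <= N x + N y;
  cnormZ : forall (c : R[i]) x, N (c *: x) = complex.Re `|c| * N x;
  cnorm_eq0 : forall x, N x = 0 -> x = 0;
  cnorm_submul : forall x y, N (x ** y) <= N x * N y;
  cnorm_cstar : forall x, N (star x ** x) = N x ^+ 2;
  cnorm_complete : forall u, cauchy_for N u -> exists l, cvg_for N u l
}.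

Definition separable_for (R : realType) (A : zmodType) (N : A -> R) : Prop :=
  exists2 D : set A, countable D &
    forall (x : A) (e : R), 0 < e -> exists2 d, D d & N (x - d) < e.

Definition weakly_projective (R : realType) (A : starAlgType R) (N : A -> R)
    : Prop :=
  [/\ cstar_norm N, separable_for N &
    forall (B C : starAlgType R) (NB : B -> R) (NC : C -> R),
      cstar_norm NB -> cstar_norm NC ->
    forall (phi : A -> C) (rho : B -> C),
      star_hom phi -> star_hom rho -> (forall c, exists b, rho b = c) ->
    exists phi_ : nat -> A -> B,
      (forall k, star_hom (phi_ k)) /\
      (forall a, cvg_for NC (fun k => rho (phi_ k a)) (phi a))].

(* An alias of ['M[A]_n], because the library's module structure on matrices
   is over the ring of coefficients, not over C. *)
Definition star_mx (n : nat) (A : Type) : Type := 'M[A]_n.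

Section StarMatrix.
Variables (R : realType) (n : nat) (A : starAlgType R).
Local Notation M := (star_mx n A).
Implicit Types (a b : M) (c : R[i]).

HB.instance Definition _ := GRing.Zmodule.copy M 'M[A]_n.

Definition smx_scale c a : M := \matrix_(i, j) (c *: (a : 'M[A]_n) i j).
Definition smx_mul a b : M :=
  \matrix_(i, j) \sum_k (a : 'M[A]_n) i k ** (b : 'M[A]_n) k j.
Definition smx_star a : M := \matrix_(i, j) star ((a : 'M[A]_n) j i).

Lemma smx_scaleA c1 c2 a :
  smx_scale c1 (smx_scale c2 a) = smx_scale (c1 * c2) a.
Proof. by apply/matrixP=> i j; rewrite !mxE scalerA. Qed.

Lemma smx_scale1 : left_id 1 smx_scale.
Proof. by move=> a; apply/matrixP=> i j; rewrite !mxE scale1r. Qed.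

Lemma smx_scaleDr : right_distributive smx_scale +%R.
Proof. by move=> c a b; apply/matrixP=> i j; rewrite !mxE scalerDr. Qed.

Lemma smx_scaleDl a : {morph smx_scale^~ a : c1 c2 / c1 + c2}.
Proof. by move=> c1 c2; apply/matrixP=> i j; rewrite !mxE scalerDl. Qed.

HB.instance Definition _ := GRing.Zmodule_isLmodule.Build R[i] M
  smx_scaleA smx_scale1 smx_scaleDr smx_scaleDl.

Lemma star0 : star (0 : A) = 0.
Proof. by apply: (addrI (star 0)); rewrite -starD !addr0. Qed.

Lemma star_sum (F : 'I_n -> A) : star (\sum_i F i) = \sum_i star (F i).
Proof. exact: (big_morph _ (@starD R A) star0). Qed.

Lemma smul0l (x : A) : 0 ** x = 0.
Proof. by apply: (addrI (0 ** x)); rewrite -smulDl !addr0. Qed.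

Lemma smul0r (x : A) : x ** 0 = 0.
Proof. by apply: (addrI (x ** 0)); rewrite -smulDr !addr0. Qed.

Lemma smul_suml (F : 'I_n -> A) x : (\sum_i F i) ** x = \sum_i F i ** x.
Proof.
by apply: (big_morph (smul^~ x)) => [y z|]; rewrite (smulDl, smul0l).
Qed.

Lemma smul_sumr (F : 'I_n -> A) x : x ** (\sum_i F i) = \sum_i x ** F i.
Proof. by apply: (big_morph (smul x)) => [y z|]; rewrite (smulDr, smul0r). Qed.

Lemma smx_mulA : associative smx_mul.
Proof.
move=> a b c; apply/matrixP=> i j; rewrite !mxE.
under eq_bigr do rewrite mxE smul_sumr.
rewrite exchange_big; apply: eq_bigr => k _ /=.
by rewrite mxE smul_suml; apply: eq_bigr => l _; rewrite smulA.
Qed.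

Lemma smx_mulDl : left_distributive smx_mul +%R.
Proof.
move=> a b c; apply/matrixP=> i j; rewrite !mxE -big_split.
by apply: eq_bigr => k _; rewrite mxE smulDl.
Qed.

Lemma smx_mulDr : right_distributive smx_mul +%R.
Proof.
move=> a b c; apply/matrixP=> i j; rewrite !mxE -big_split.
by apply: eq_bigr => k _; rewrite mxE smulDr.
Qed.

Lemma smx_mulZl c a b : smx_mul (c *: a) b = c *: smx_mul a b.
Proof.
apply/matrixP=> i j; rewrite !mxE scaler_sumr.
by apply: eq_bigr => k _; rewrite mxE smulZl.
Qed.

Lemma smx_mulZr c a b : smx_mul a (c *: b) = c *: smx_mul a b.
Proof.
apply/matrixP=> i j; rewrite !mxE scaler_sumr.
by apply: eq_bigr => k _; rewrite mxE smulZr.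
Qed.

Lemma smx_starK : involutive smx_star.
Proof. by move=> a; apply/matrixP=> i j; rewrite !mxE starK. Qed.

Lemma smx_starD : {morph smx_star : a b / a + b}.
Proof. by move=> a b; apply/matrixP=> i j; rewrite !mxE starD. Qed.

Lemma smx_starZ c a : smx_star (c *: a) = c^* *: smx_star a.
Proof. by apply/matrixP=> i j; rewrite !mxE starZ. Qed.

Lemma smx_starM a b : smx_star (smx_mul a b) = smx_mul (smx_star b) (smx_star a).
Proof.
apply/matrixP=> i j; rewrite !mxE star_sum.
by apply: eq_bigr => k _; rewrite !mxE starM.
Qed.

HB.instance Definition _ := Lmodule_isStarAlgebra.Build R M
  smx_mulA smx_mulDl smx_mulDr smx_mulZl smx_mulZr
  smx_starK smx_starD smx_starZ smx_starM.

(* The C*-norm of M_n(A) is the operator norm for the action on the Hilbert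
   A-module A^n, whose norm is |x| = |x_1^* x_1 + ... + x_n^* x_n|^(1/2).
   It is the only norm making the *-algebra M_n(A) a C*-algebra. *)

Definition col_norm (N : A -> R) (x : 'cV[A]_n) : R :=
  Num.sqrt (N (\sum_i star (x i 0) ** x i 0)).

Definition smx_col (a : M) (x : 'cV[A]_n) : 'cV[A]_n :=
  \col_i \sum_j (a : 'M[A]_n) i j ** x j 0.

Definition star_mx_norm (N : A -> R) (a : M) : R :=
  sup [set col_norm N (smx_col a x) | x in [set x | col_norm N x <= 1]].

End StarMatrix.

(* Main.v *)
(* By separability A contains a positive h with closure (h A h) = A. Given
   phi : M_n(A) -> C and a surjection rho : B -> C, functional calculus lifts the
   column phi(g (x) e_il), g a power of h, to x_1, ..., x_n in B with
   x_i^* x_j = delta_ij K: orthogonality comes from positive and negative parts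
   of self-adjoint lifts, equality of the x_i^* x_i from taking as new entry the
   absolute value |z| of a product z. The closure D of x_1 B x_1^* then carries
   a *-homomorphism M_n(D) -> B sending d (x) e_ij to x_i b x_j^* when
   d = x_1 b x_1^*. The pairs (d, a) such that d (x) e_ij lifts phi(a (x) e_ij)
   form a C*-algebra which surjects onto A, because a *-homomorphism with dense
   image is onto; weak projectivity of A, applied to this surjection and to the
   identity of A, yields *-homomorphisms A -> D, hence M_n(A) -> M_n(D) -> B.

   The C*-theory this needs, including the fact that the operator norm of M_n(A)
   is a C*-norm, avoids spectra: positive elements are the squares of
   self-adjoint ones, square roots are limits of a polynomial iteration, and
   norm estimates come from (b + ic)^* (b + ic) = b^2 + c^2 for commuting
   self-adjoint b and c. *)

Require Import Defs.
From Stdlib Require Ncring Ncring_tac.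
From HB Require Import structures.
From mathcomp Require Import all_boot all_order all_algebra.
From mathcomp Require Import all_classical all_reals all_analysis.
From mathcomp.real_closed Require Import complex.
From mathcomp Require Import ring lra.

Set Implicit Arguments.
Unset Strict Implicit.
Unset Printing Implicit Defensive.

Import Order.TTheory GRing.Theory Num.Theory.
Import numFieldNormedType.Exports.

Local Open Scope classical_set_scope.
Local Open Scope ring_scope.
Local Open Scope complex_scope.
Local Open Scope star_scope.

(** * Star algebras and C*-norms *)

(** The matrix units [e_ij] cannot be lifted themselves: [A] has no unit, so only elements
    [a (x) e_ij] exist, and a partial isometry of [C] need not lift along [rho] to a partial
    isometry. A single column is enough, because [x_i b x_j^*] and [x_k b' x_l^*] multiply like
    matrix units as soon as [x_j^* x_k = delta_jk K], whatever [K] is. Each enlargement of the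
    column multiplies its coefficient by further powers of [h]. This is harmless, since [g A g] is
    dense for every power [g] of [h], and density of the range is all that the surjection onto [A]
    requires. The pairs keep [a] because [d] determines it only modulo the elements that [phi] kills
    in every position; with [a] recorded, the surjection ends in [A] itself and no ideal has to be
    discussed. Approximation enters only through the weak projectivity of [A]: [rho] sends the lift
    attached to a matrix to [phi] of a matrix whose entries approximate the given ones. *)

Section StarAlgebraTheory.
Variables (R : realType) (A : starAlgType R).
Implicit Types x y z : A.

Lemma smulNl x y : (- x) ** y = - (x ** y).
Proof. by apply/eqP; rewrite -addr_eq0 -smulDl addNr smul0l. Qed.

Lemma smulNr x y : x ** (- y) = - (x ** y).
Proof. by apply/eqP; rewrite -addr_eq0 -smulDr addNr smul0r. Qed.

Lemma smulBl x y z : (x - y) ** z = x ** z - y ** z.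
Proof. by rewrite smulDl smulNl. Qed.

Lemma smulBr x y z : x ** (y - z) = x ** y - x ** z.
Proof. by rewrite smulDr smulNr. Qed.

Lemma starN x : star (- x) = - star x.
Proof. by apply/eqP; rewrite -addr_eq0 -starD addNr star0. Qed.

Lemma starB x y : star (x - y) = star x - star y.
Proof. by rewrite starD starN. Qed.

Lemma conjC_real (r : R) : (r%:C)^*%R = r%:C.
Proof. by rewrite conj_Creal// complex_real. Qed.

Lemma starZ_real (r : R) x : star (r%:C *: x) = r%:C *: star x.
Proof. by rewrite starZ conjC_real. Qed.

Lemma star_addsa x y : star x = x -> star y = y -> star (x + y) = x + y.
Proof. by rewrite starD => -> ->. Qed.

Lemma scaleRA (r s : R) x : r%:C *: (s%:C *: x) = (r * s)%:C *: x.
Proof. by rewrite scalerA -rmorphM. Qed.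

Lemma scale1R x : (1 : R)%:C *: x = x.
Proof. by rewrite rmorph1 scale1r. Qed.

Lemma scaleRD (r s : R) x : (r + s)%:C *: x = r%:C *: x + s%:C *: x.
Proof. by rewrite rmorphD scalerDl. Qed.

Lemma halfZ_double x : 2^-1%:C *: (x + x) = x.
Proof.
by rewrite scalerDr -scaleRD -[RHS]scale1R; congr (_%:C *: _); field.
Qed.

End StarAlgebraTheory.

Section Limits.
Variables (R : realType) (A : zmodType) (N : A -> R).
Hypothesis N_ge0 : forall x, 0 <= N x.

Lemma cvg_forP (u : nat -> A) (l : A) :
  cvg_for N u l <->
  forall e : R, 0 < e -> exists K : nat, forall k, (K <= k)%N -> N (u k - l) < e.
Proof.
rewrite /cvg_for; split=> [/cvgrPdist_lt ucvg e e_gt0|ucvg].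
  have [K _ HK] := ucvg _ e_gt0; exists K => k Kk.
  by have := HK k Kk; rewrite /= sub0r normrN ger0_norm.
apply/cvgrPdist_lt => e e_gt0; have [K HK] := ucvg _ e_gt0.
by exists K => // k /= Kk; rewrite sub0r normrN ger0_norm ?HK.
Qed.

End Limits.

Section CstarBasics.
Variables (R : realType) (A : starAlgType R) (N : A -> R).
Hypothesis hN : cstar_norm N.
Implicit Types (x y z : A) (u v : nat -> A) (r e : R).

Lemma normC_real r : complex.Re `|r%:C| = `|r|.
Proof. by rewrite normc_def /= expr0n /= addr0 sqrtr_sqr. Qed.

Lemma cnormR r x : N (r%:C *: x) = `|r| * N x.
Proof. by rewrite (cnormZ hN) normC_real. Qed.

Lemma cnorm0 : N 0 = 0.
Proof. by rewrite -(scale0r (0 : A)) (cnormZ hN) normr0 mul0r. Qed.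

Lemma cnormN x : N (- x) = N x.
Proof. by rewrite -scaleN1r (cnormZ hN) normrN normr1 mul1r. Qed.

Lemma cnorm_ge0 x : 0 <= N x.
Proof.
have := cnorm_triangle hN x (- x).
by rewrite subrr cnormN cnorm0 -mulr2n pmulrn_lge0.
Qed.

Lemma cnorm_distC x y : N (x - y) = N (y - x).
Proof. by rewrite -cnormN opprB. Qed.

Lemma cnorm_distT y x z : N (x - z) <= N (x - y) + N (y - z).
Proof. by rewrite (le_trans _ (cnorm_triangle hN _ _))// addrA subrK. Qed.

Lemma cnorm_star x : N (star x) = N x.
Proof.
suff le y : N y <= N (star y) by apply/le_anti; rewrite le -{2}(starK x) le.
have [->|y_neq0] := eqVneq (N y) 0; first exact: cnorm_ge0.
have y_gt0 : 0 < N y by rewrite lt_neqAle eq_sym y_neq0 cnorm_ge0.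
by rewrite -(ler_pM2r y_gt0) -expr2 -(cnorm_cstar hN) (cnorm_submul hN).
Qed.

Lemma cnorm_cstar' x : N (x ** star x) = N x ^+ 2.
Proof. by rewrite -{1}(starK x) (cnorm_cstar hN) cnorm_star. Qed.

Lemma cnorm_sa x : star x = x -> N (x ** x) = N x ^+ 2.
Proof. by move=> xsa; rewrite -(cnorm_cstar hN) xsa. Qed.

Lemma cnorm_le0 x : N x <= 0 -> x = 0.
Proof.
by move=> Nx; apply: (cnorm_eq0 hN); apply/le_anti; rewrite Nx cnorm_ge0.
Qed.

Lemma star_smul_eq0 x : star x ** x = 0 -> x = 0.
Proof.
move=> xx; apply: (cnorm_eq0 hN); apply/eqP.
by rewrite -sqrf_eq0 -(cnorm_cstar hN) xx cnorm0.
Qed.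

Lemma cnorm_sum (I : Type) (s : seq I) (P : pred I) (F : I -> A) :
  N (\sum_(i <- s | P i) F i) <= \sum_(i <- s | P i) N (F i).
Proof.
elim/big_ind2 : _ => [|x1 x2 y1 y2 H1 H2|//]; first by rewrite cnorm0.
by rewrite (le_trans (cnorm_triangle hN _ _))// lerD.
Qed.

Lemma cvg_for_unique u x y : cvg_for N u x -> cvg_for N u y -> x = y.
Proof.
move=> /(cvg_forP cnorm_ge0) ux /(cvg_forP cnorm_ge0) uy.
apply/eqP; rewrite -subr_eq0; apply/eqP; apply: cnorm_le0.
apply/ler_addgt0Pr => e e_gt0; rewrite add0r.
have e2 : 0 < e / 2 by rewrite divr_gt0.
have [K HK] := ux _ e2; have [L HL] := uy _ e2.
have xk := HK _ (leq_maxl K L); have yk := HL _ (leq_maxr K L).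
rewrite (le_trans (cnorm_distT (u (maxn K L)) _ _))// cnorm_distC.
by rewrite [leRHS](splitr e) lerD ?ltW.
Qed.

Lemma cvg_for_cst x : cvg_for N (fun=> x) x.
Proof. by apply/(cvg_forP cnorm_ge0) => e e0; exists 0%N => k _; rewrite subrr cnorm0. Qed.

Lemma cvg_for_bounded_by u x (v : nat -> R) :
  (forall k, N (u k - x) <= v k) -> v k @[k --> \oo] --> (0 : R) -> cvg_for N u x.
Proof.
move=> uv v0; apply: (@squeeze_cvgr _ _ _ _ (fun=> 0) v) => //; last exact: cvg_cst.
by near=> k; rewrite cnorm_ge0 uv.
Unshelve. all: by end_near.
Qed.

Lemma cnorm_cvg u x : cvg_for N u x -> N (u k) @[k --> \oo] --> N x.
Proof.
move=> /(cvg_forP cnorm_ge0) ux; apply/cvgrPdist_lt => e /ux[K HK].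
exists K => // k /= Kk; rewrite (le_lt_trans _ (HK _ Kk))// ler_norml.
have := cnorm_triangle hN (u k - x) x; have := cnorm_triangle hN (x - u k) (u k).
by rewrite !subrK (cnorm_distC x) => ? ?; apply/andP; split; lra.
Qed.

Lemma cvg_forD u v x y :
  cvg_for N u x -> cvg_for N v y -> cvg_for N (fun k => u k + v k) (x + y).
Proof.
move=> ux vy; apply: (@cvg_for_bounded_by _ _ (fun k => N (u k - x) + N (v k - y))).
  by move=> k; rewrite opprD addrACA (cnorm_triangle hN).
by rewrite -[X in _ --> X]addr0; exact: cvgD.
Qed.

Lemma cvg_forZ (c : R[i]) u x :
  cvg_for N u x -> cvg_for N (fun k => c *: u k) (c *: x).
Proof.
move=> ux; apply: (@cvg_for_bounded_by _ _ (fun k => complex.Re `|c| * N (u k - x))).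
  by move=> k; rewrite -scalerBr (cnormZ hN).
by rewrite -[X in _ --> X](mulr0 (complex.Re `|c|)); exact: cvgZr.
Qed.

Lemma cvg_forN u x : cvg_for N u x -> cvg_for N (fun k => - u k) (- x).
Proof.
move=> ux; apply: (@cvg_for_bounded_by _ _ (fun k => N (u k - x))) => // k.
by rewrite -opprD cnormN.
Qed.

Lemma cvg_forB u v x y :
  cvg_for N u x -> cvg_for N v y -> cvg_for N (fun k => u k - v k) (x - y).
Proof. by move=> ux /cvg_forN; exact: cvg_forD. Qed.

Lemma cvg_for_star u x : cvg_for N u x -> cvg_for N (fun k => star (u k)) (star x).
Proof.
move=> ux; apply: (@cvg_for_bounded_by _ _ (fun k => N (u k - x))) => // k.
by rewrite -starB cnorm_star.
Qed.

Lemma cvg_forMr u x y : cvg_for N u x -> cvg_for N (fun k => u k ** y) (x ** y).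
Proof.
move=> ux; apply: (@cvg_for_bounded_by _ _ (fun k => N (u k - x) * N y)).
  by move=> k; rewrite -smulBl (cnorm_submul hN).
by rewrite -[X in _ --> X](mul0r (N y)); exact: cvgMl.
Qed.

Lemma cvg_forMl u x y : cvg_for N u x -> cvg_for N (fun k => y ** u k) (y ** x).
Proof.
move=> ux; apply: (@cvg_for_bounded_by _ _ (fun k => N y * N (u k - x))).
  by move=> k; rewrite -smulBr (cnorm_submul hN).
by rewrite -[X in _ --> X](mulr0 (N y)); exact: cvgMr.
Qed.

Lemma cvg_for_bounded u x : cvg_for N u x -> exists M, forall k, N (u k) <= M.
Proof.
move=> /(cvg_forP cnorm_ge0) /(_ 1 ltr01)[K HK].
exists (N x + 1 + \sum_(k < K) N (u k)) => k.
have [Kk|kK] := leqP K k.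
  rewrite -[u k](subrK x) (le_trans (cnorm_triangle hN _ _))// addrC -addrA lerD2l.
  by rewrite (le_trans (ltW (HK _ Kk)))// lerDl sumr_ge0// => i _; exact: cnorm_ge0.
rewrite (bigD1 (Ordinal kK))//= addrCA lerDl addr_ge0 ?sumr_ge0//.
  by rewrite addr_ge0 ?cnorm_ge0.
by move=> i _; exact: cnorm_ge0.
Qed.

Lemma cvg_forM u v x y :
  cvg_for N u x -> cvg_for N v y -> cvg_for N (fun k => u k ** v k) (x ** y).
Proof.
move=> ux vy; have [M HM] := cvg_for_bounded vy.
apply: (@cvg_for_bounded_by _ _ (fun k => N (u k - x) * M + N x * N (v k - y))).
  move=> k; rewrite -(subrK (x ** v k) (u k ** v k)) -smulBl -addrA -smulBr.
  rewrite (le_trans (cnorm_triangle hN _ _))// lerD ?(cnorm_submul hN)//.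
  by rewrite (le_trans (cnorm_submul hN _ _))// ler_wpM2l ?cnorm_ge0.
rewrite -[X in _ --> X]addr0 -[X in X + _](mul0r M) -[X in _ + X](mulr0 (N x)).
by apply: cvgD; [exact: cvgMl|exact: cvgMr].
Qed.

Lemma cvg_for_shift u x : cvg_for N u x -> cvg_for N (fun k => u k.+1) x.
Proof. by rewrite /cvg_for => ux; rewrite -(@cvg_shiftS _ (fun k => N (u k - x))) in ux *. Qed.

Lemma cvg_for_le u x r : cvg_for N u x -> (forall k, N (u k) <= r) -> N x <= r.
Proof.
move=> /(cvg_forP cnorm_ge0) ux ur; apply/ler_addgt0Pr => e /ux[K HK].
rewrite -(subrK (u K) x) (le_trans (cnorm_triangle hN _ _))// addrC lerD//.
by rewrite cnorm_distC ltW// HK.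
Qed.

(** Majorant principle: [v] is nondecreasing and bounded, hence Cauchy, and [u] inherits this. It
    gives the limits behind square roots, resolvents, strictly positive elements and exact
    preimages. *)
Lemma cvg_for_dominated u (v : nat -> R) (M : R) :
  (forall k, N (u k.+1 - u k) <= v k.+1 - v k) -> (forall k, v k <= M) ->
  exists l, cvg_for N u l.
Proof.
move=> uv vM; apply: (cnorm_complete hN).
have v_nd : nondecreasing_seq v.
  by apply/nondecreasing_seqP => k; rewrite -subr_ge0 (le_trans _ (uv k))// cnorm_ge0.
have dist p q : (p <= q)%N -> N (u q - u p) <= v q - v p.
  move=> /subnK <-; elim: (q - p)%N => [|k IH]; first by rewrite add0n !subrr cnorm0.
  rewrite addSn (le_trans (cnorm_distT (u (k + p)%N) _ _))//.
  by rewrite (le_trans (lerD (uv _) IH))// addrA subrK.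
have /cvgrPdist_lt vcvg : cvgn v.
  by apply: nondecreasing_is_cvgn => //; exists M => _ [k _ <-].
move=> e e_gt0; have [K _ HK] := vcvg _ (divr_gt0 e_gt0 (ltr0Sn R 1)).
exists K => p q Kp Kq; wlog pq : p q Kp Kq / (q <= p)%N.
  by move=> H; have [/H->//|/ltnW/H] := leqP q p; rewrite cnorm_distC => ->.
rewrite (le_lt_trans (dist _ _ pq))// -(subrK (limn v) (v p)) -addrA.
rewrite (le_lt_trans (ler_norm _))// (le_lt_trans (ler_normD _ _))//.
by rewrite [ltRHS]splitr ltrD//; [rewrite distrC|]; exact: HK.
Qed.

End CstarBasics.

(** * Positive elements of unital C*-algebras *)

(** This form mentions neither unit nor norm, so star homomorphisms preserve it at once and it can
    be compared between an algebra and its unitization. *)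
Definition pos (R : realType) (A : starAlgType R) (a : A) : Prop :=
  exists2 b, star b = b & a = b ** b.

Lemma pos_sa (R : realType) (A : starAlgType R) (a : A) : pos a -> star a = a.
Proof. by move=> [b bsa ->]; rewrite starM bsa. Qed.

Lemma pos0 (R : realType) (A : starAlgType R) : pos (0 : A).
Proof. by exists 0; rewrite ?star0 ?smul0l. Qed.

Lemma posZ (R : realType) (A : starAlgType R) (r : R) (a : A) :
  0 <= r -> pos a -> pos (r%:C *: a).
Proof.
move=> r_ge0 [b bsa ->]; exists ((Num.sqrt r)%:C *: b); first by rewrite starZ_real bsa.
by rewrite smulZl smulZr scaleRA -expr2 sqr_sqrtr.
Qed.

Section Unital.
Variables (R : realType) (A : starAlgType R) (N : A -> R).
Hypothesis hN : cstar_norm N.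
Variable e : A.
Hypotheses (mul1a : left_id e (@smul R A)) (mula1 : right_id e (@smul R A)).
Implicit Types (a b c p q x y z : A) (t : R).

(* For the tactic [non_commutative_ring]. *)
#[local] Instance unital_ring_ops :
  @Ncring.Ring_ops A 0 e (fun x y => x + y) (@smul R A)
    (fun x y => x - y) (@GRing.opp A) (@eq A).
Defined.

#[local] Instance unital_ring : @Ncring.Ring A _ _ _ _ _ _ _ unital_ring_ops.
Proof.
split; rewrite /Algebra_syntax.equality/=; try (by repeat move=> ? ? ->).
all: first [exact: RelationClasses.eq_equivalence | exact: add0r
  | exact: addrC | exact: addrA | exact: mul1a | exact: mula1 | exact: smulA
  | exact: smulDl | by move=> x y z; exact: smulDr | exact: subrr].
Qed.

Local Ltac ncring := Ncring_tac.non_commutative_ring.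

Lemma star_unit : star e = e.
Proof. by rewrite -(mul1a (star e)) -{1}(starK e) -starM mul1a starK. Qed.

Lemma cnorm_unit_le1 : N e <= 1.
Proof.
have := cnorm_cstar hN e; rewrite star_unit mul1a => Ne.
have [->|Ne0] := eqVneq (N e) 0; first exact: ler01.
by rewrite le_eqVlt; apply/orP; left; apply/eqP/(mulfI Ne0); rewrite mulr1 -expr2.
Qed.

Lemma cnorm_scalar_le t : 0 <= t -> N (t%:C *: e) <= t.
Proof.
by move=> t0; rewrite (cnormR hN) ger0_norm// ler_piMr// cnorm_unit_le1.
Qed.

Lemma star_scalar t : star (t%:C *: e) = t%:C *: e.
Proof. by rewrite starZ_real star_unit. Qed.

Lemma scalar_mul t x : (t%:C *: e) ** x = t%:C *: x.
Proof. by rewrite smulZl mul1a. Qed.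

Lemma mul_scalar t x : x ** (t%:C *: e) = t%:C *: x.
Proof. by rewrite smulZr mula1. Qed.

Section Sqrt.
Variables (a : A).
Hypotheses (asa : star a = a) (Na : N (e - a) <= 1).

Let w := fix w (k : nat) : A :=
  if k is k'.+1 then 2^-1%:C *: (w k' ** w k' + (e - a)) else 0.
Let v := fix v (k : nat) : R :=
  if k is k'.+1 then (v k' ^+ 2 + 1) / 2 else 0.

Let v_bounds k : 0 <= v k <= 1.
Proof. by elim: k => [|k IH] /=; [rewrite lexx ler01|nra]. Qed.

Let w_comm x : x ** a = a ** x -> forall k, x ** w k = w k ** x.
Proof.
move=> xa; elim=> [|k IH] /=; first by rewrite smul0l smul0r.
rewrite smulZl smulZr; congr (_ *: _).
rewrite smulDl smulDr smulBl smulBr mul1a mula1 xa; congr (_ + _).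
by rewrite smulA IH -smulA IH smulA.
Qed.

Let wa k : w k ** a = a ** w k. Proof. by rewrite w_comm. Qed.

Let w_sa k : star (w k) = w k.
Proof.
elim: k => [|k IH] /=; first exact: star0.
by rewrite starZ_real starD starM starB star_unit asa IH.
Qed.

Let w_norm k : N (w k) <= v k.
Proof.
elim: k => [|k IH] /=; first by rewrite (cnorm0 hN).
rewrite (cnormR hN) ger0_norm ?invr_ge0// mulrC ler_wpM2r ?invr_ge0//.
rewrite (le_trans (cnorm_triangle hN _ _))// lerD//.
by rewrite (le_trans (cnorm_submul hN _ _))// expr2 ler_pM ?(cnorm_ge0 hN).
Qed.

(** All iterates commute, so the difference of two consecutive squares factors; the scalar iteration
    satisfies the same identity, and the factors are compared one by one. *)
Let w_step k : N (w k.+1 - w k) <= v k.+1 - v k.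
Proof.
elim: k => [|k IH].
  rewrite /= !subr0 smul0l add0r expr0n /= add0r (cnormR hN).
  by rewrite ger0_norm ?invr_ge0// mul1r ler_piMr ?invr_ge0.
have -> : w k.+2 - w k.+1 = 2^-1%:C *: ((w k.+1 - w k) ** (w k.+1 + w k)).
  have -> : (w k.+1 - w k) ** (w k.+1 + w k) =
            (w k.+1 ** w k.+1 + (e - a)) - (w k ** w k + (e - a)).
    by rewrite smulBl !smulDr (w_comm (wa k.+1) k); ncring.
  by rewrite scalerBr.
have -> : v k.+2 - v k.+1 = 2^-1 * ((v k.+1 - v k) * (v k.+1 + v k)).
  transitivity ((v k.+1 ^+ 2 + 1) / 2 - (v k ^+ 2 + 1) / 2); first by [].
  by field.
rewrite (cnormR hN) ger0_norm ?invr_ge0// ler_wpM2l ?invr_ge0//.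
rewrite (le_trans (cnorm_submul hN _ _))// ler_pM ?(cnorm_ge0 hN)//.
by rewrite (le_trans (cnorm_triangle hN _ _))// lerD.
Qed.

(* The limit [w] of the iteration solves [w = (w ** w + (e - a)) / 2], so that
   [e - w] squares to [a]; the scalar iteration [v] dominates it. *)
Lemma sqrt_near_unit :
  exists s, [/\ star s = s, s ** s = a, N (e - s) <= 1 &
    forall x, x ** a = a ** x -> x ** s = s ** x].
Proof.
have [l wl] : exists l, cvg_for N w l.
  by apply: (cvg_for_dominated hN w_step (M := 1)) => k; case/andP: (v_bounds k).
have lE : l + l = l ** l + (e - a).
  rewrite -(halfZ_double (l ** l + _)) scalerDr; set h := _ *: _.
  suff -> : l = h by [].
  apply: (cvg_for_unique hN (cvg_for_shift wl)).
  apply: (cvg_forZ hN); apply: (cvg_forD hN); last exact: cvg_for_cst.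
  exact: (cvg_forM hN wl wl).
have Nl : N l <= 1.
  by apply: (cvg_for_le hN wl) => k; rewrite (le_trans (w_norm k))//; case/andP: (v_bounds k).
exists (e - l); split.
- rewrite starB star_unit; congr (_ - _); apply: (cvg_for_unique hN _ wl).
  by have := cvg_for_star hN wl; under eq_fun do rewrite w_sa.
- have -> : (e - l) ** (e - l) = e + l ** l - (l + l) by ncring.
  by rewrite lE; ncring.
- by rewrite opprB addrC subrK.
- move=> x xa; rewrite smulBl smulBr mul1a mula1; congr (_ - _).
  apply: (cvg_for_unique hN (cvg_forMl hN _ wl)).
  by under eq_fun do rewrite w_comm//; exact: (cvg_forMr hN).
Qed.

End Sqrt.

Lemma conjC_i : ('i : R[i])^*%R = - 'i.
Proof. by rewrite -[LHS]/(conjc 'i) /=; simpc. Qed.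

(** [b] is half of [u + star u] for [u = b + 'i *: c], so [N b <= N u]; squaring and the C*-identity
    give the bound. *)
Lemma cnorm_sumsq b c t : star b = b -> star c = c -> b ** c = c ** b ->
  N (b ** b + c ** c) <= t -> N (b ** b) <= t.
Proof.
move=> bsa csa bc Nbc; pose u := b + 'i *: c.
have us : star u = b - 'i *: c.
  by rewrite starD starZ bsa csa conjC_i scaleNr.
have uu : star u ** u = b ** b + c ** c.
  rewrite us smulBl !smulDr !smulZl !smulZr scalerA -expr2.
  rewrite sqr_i scaleN1r bc; set d := 'i *: _.
  by rewrite opprD opprK addrA addrK.
have b2 : b + b = u + star u by rewrite us /u addrACA subrr addr0.
rewrite (cnorm_sa hN)// (le_trans _ Nbc)// -uu (cnorm_cstar hN).
rewrite ler_pXn2r ?nnegrE ?(cnorm_ge0 hN)//.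
have := cnorm_triangle hN u (star u); rewrite -b2 (cnorm_star hN).
have -> : b + b = 2%:C *: b by rewrite -[2]/(1 + 1) scaleRD scale1R.
by rewrite (cnormR hN) ger0_norm//; lra.
Qed.

(** For [a = b ** b], the element [e - a] is within distance 1 of [e] and has a root [c] commuting
    with [b]. Then [c ** c + b ** b = e], so [c ** c = e - a] has norm at most that of [e]. *)
Lemma pos_near_unit a : pos a -> N a <= 1 -> N (e - a) <= 1.
Proof.
move=> [b bsa ->] Nb.
have [||c [csa cc _ bc]] := @sqrt_near_unit (e - b ** b).
- by rewrite starB starM bsa star_unit.
- by rewrite opprB addrC subrK.
have {}bc : c ** b = b ** c.
  by symmetry; apply: bc; rewrite smulBl smulBr mul1a mula1 smulA.
rewrite -cc; apply: (@cnorm_sumsq c b) => //.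
by rewrite cc subrK cnorm_unit_le1.
Qed.

Lemma scale_dist t a : 0 < t ->
  t%:C *: e - a = t%:C *: (e - t^-1%:C *: a).
Proof. by move=> t0; rewrite scalerBr scaleRA divff ?gt_eqF// scale1R. Qed.

Lemma pos_near_scalar a t : pos a -> N a <= t -> 0 < t -> N (t%:C *: e - a) <= t.
Proof.
move=> apos Na t0; rewrite scale_dist// (cnormR hN) gtr0_norm// ler_piMr ?(ltW t0)//.
apply: pos_near_unit; first by apply: posZ => //; rewrite invr_ge0 ltW.
by rewrite (cnormR hN) gtr0_norm ?invr_gt0// ler_pdivrMl// mulr1.
Qed.

Lemma sqrt_near_scalar a t : star a = a -> 0 < t -> N (t%:C *: e - a) <= t ->
  exists s, [/\ pos s, s ** s = a & forall x, x ** a = a ** x -> x ** s = s ** x].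
Proof.
move=> asa t0; rewrite scale_dist// (cnormR hN) gtr0_norm// => Na.
have [||s [ssa ss Ns sx]] := @sqrt_near_unit (t^-1%:C *: a).
- by rewrite starZ_real asa.
- by rewrite -(ler_pM2l t0) mulr1.
(* The bound [N (e - s) <= 1] on the first root permits a second extraction, which shows that [s] is
   itself a square. *)
have [||q [qsa qq _ _]] := @sqrt_near_unit s => //.
exists ((Num.sqrt t)%:C *: s); split.
- by apply: posZ; rewrite ?sqrtr_ge0//; exists q.
- rewrite smulZl smulZr scaleRA -expr2 sqr_sqrtr ?ltW// ss scaleRA divff ?gt_eqF//.
  by rewrite scale1R.
- by move=> x xa; rewrite smulZl smulZr sx// smulZl smulZr xa.
Qed.

(** Together with [pos_near_scalar] this makes positivity of self-adjoint elements a norm condition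
    that is stable under sums and limits, whence [posD] and [pos_lim]. *)
Lemma pos_of_near_scalar a t :
  star a = a -> 0 < t -> N (t%:C *: e - a) <= t -> pos a.
Proof.
move=> asa t0 Na; have [s [/pos_sa ssa ss _]] := sqrt_near_scalar asa t0 Na.
by exists s.
Qed.

(** The radius [N a + 1] stays nonzero when [a] vanishes. *)
Lemma norm1_gt0 a : 0 < N a + 1. Proof. by rewrite ltr_wpDl ?(cnorm_ge0 hN). Qed.

Lemma norm1_ge a : N a <= N a + 1. Proof. by rewrite lerDl. Qed.

Lemma pos_sqrt a : pos a ->
  exists s, [/\ pos s, s ** s = a & forall x, x ** a = a ** x -> x ** s = s ** x].
Proof.
move=> apos; apply: (sqrt_near_scalar (pos_sa apos) (norm1_gt0 a)).
exact: pos_near_scalar (norm1_ge a) (norm1_gt0 a).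
Qed.

Lemma posD a b : pos a -> pos b -> pos (a + b).
Proof.
move=> apos bpos; apply: (@pos_of_near_scalar _ ((N a + 1) + (N b + 1))).
- by rewrite star_addsa// pos_sa.
- by rewrite addr_gt0// norm1_gt0.
rewrite scaleRD opprD addrACA (le_trans (cnorm_triangle hN _ _))//.
by rewrite lerD// pos_near_scalar ?norm1_gt0 ?norm1_ge.
Qed.

Lemma posM a b : pos a -> pos b -> a ** b = b ** a -> pos (a ** b).
Proof.
move=> apos bpos ab.
have [s [/pos_sa ssa ss sx]] := pos_sqrt apos.
have [r [/pos_sa rsa rr rx]] := pos_sqrt bpos.
have sb : s ** b = b ** s by symmetry; apply: sx; rewrite ab.
have sr : s ** r = r ** s by apply: rx.
exists (s ** r); first by rewrite starM ssa rsa.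
by rewrite -ss -rr -!smulA; congr (_ ** _); rewrite !smulA sr.
Qed.

(** A root [c] of [t e - p] commutes with the root [b] of [p], and [b ** b + c ** c] is the scalar
    [t]. *)
Lemma pos_le_norm p t : 0 <= t -> pos p -> pos (t%:C *: e - p) -> N p <= t.
Proof.
move=> t0 [b bsa ->] /pos_sqrt[c [/pos_sa csa cc cx]].
have bc : b ** c = c ** b.
  by apply: cx; rewrite smulBl smulBr scalar_mul mul_scalar smulA.
apply: (cnorm_sumsq bsa csa bc).
by rewrite cc addrC subrK cnorm_scalar_le.
Qed.

Lemma sa_le_norm a t : star a = a -> 0 < t -> N a <= t -> pos (t%:C *: e - a).
Proof.
move=> asa t0 Na; apply: (@pos_of_near_scalar _ t) => //.
  by rewrite starB star_scalar asa.
by rewrite opprB addrC subrK.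
Qed.

Lemma pos_mono p q : pos p -> pos (q - p) -> N p <= N q.
Proof.
move=> ppos qppos; have qpos : pos q by rewrite -(subrK p q); exact: posD.
apply/ler_addgt0Pr => r r0; have t0 : 0 < N q + r by rewrite ltr_wpDl ?(cnorm_ge0 hN).
apply: pos_le_norm => //; first exact: ltW.
rewrite -(subrK q ((N q + r)%:C *: e)) -addrA; apply: posD => //.
by apply: sa_le_norm; rewrite ?pos_sa// lerDl ltW.
Qed.

(** This replaces the comparison of the spectra of [x ** star x] and [star x ** x]: the former is
    shown positive, and if [x] is nonzero the norm of an expression in [c ** c] is bounded in two
    incompatible ways. *)
Lemma star_smul_neg_sq x c : star c = c -> star x ** x = - (c ** c) -> x = 0.
Proof.
move=> csa xx; set y := star x in xx.
have xy_pos : pos (x ** y).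
  pose p := x + y; pose q := 'i *: (x - y).
  have psa : star p = p by rewrite starD starK addrC.
  have qsa : star q = q.
    by rewrite /q starZ starB starK conjC_i scaleNr -scalerN opprB.
  have qq : q ** q = - ((x - y) ** (x - y)).
    by rewrite smulZl smulZr scalerA -expr2 sqr_i scaleN1r.
  rewrite -(halfZ_double (x ** y)); apply: posZ; first by rewrite invr_ge0.
  (* [p] and [q] are, up to sign, twice the real and imaginary parts of [x], so [p ** p + q ** q] is
     twice [x ** y + y ** x]. *)
  have -> : x ** y + x ** y = (p ** p + q ** q) + (c ** c + c ** c).
    have -> : c ** c = - (y ** x) by rewrite xx opprK.
    by rewrite qq /p; ncring.
  by do 2?apply: posD; [exists p|exists q|exists c|exists c].
have [Nx|/eqP Nx] := eqVneq (N x) 0; first exact: (cnorm_eq0 hN).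
have s0 : 0 < N x ^+ 2 by rewrite exprn_gt0// lt_neqAle eq_sym (cnorm_ge0 hN) andbT; apply/eqP.
set s := N x ^+ 2 in s0.
have Ncc : N (c ** c) = s by rewrite -(cnormN hN) -xx (cnorm_cstar hN).
have Nxy : N (s%:C *: e - x ** y) <= s.
  by apply: pos_near_scalar; rewrite ?(cnorm_cstar' hN).
have cc_pos : pos (c ** c) by exists c.
(* Conjugating [s e - x ** y], of norm at most [s], by [x] bounds this norm by [s ^+ 2]. But
   [c ** c] has norm [s], so the expression dominates twice the square of [c ** c], whose norm is
   [2 s ^+ 2]. *)
have le : N (s%:C *: (c ** c) + (c ** c) ** (c ** c)) <= s ^+ 2.
  have -> : s%:C *: (c ** c) + (c ** c) ** (c ** c) =
            - (y ** (s%:C *: e - x ** y) ** x).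
    have -> : y ** (s%:C *: e - x ** y) ** x =
              y ** ((s%:C *: e) ** x) - (y ** x) ** (y ** x) by ncring.
    by rewrite scalar_mul smulZr xx scalerN; ncring.
  rewrite (cnormN hN) (le_trans (cnorm_submul hN _ _))//.
  rewrite (le_trans (ler_wpM2r (cnorm_ge0 hN _) (cnorm_submul hN _ _)))//.
  by rewrite (cnorm_star hN) mulrAC -expr2 -/s [leRHS]expr2 ler_wpM2l ?(ltW s0).
have := le; rewrite leNgt => /negP[].
have csq : star (c ** c) = c ** c by rewrite starM csa.
apply: (@lt_le_trans _ _ (N ((c ** c) ** (c ** c) + (c ** c) ** (c ** c)))).
  have -> : (c ** c) ** (c ** c) + (c ** c) ** (c ** c) =
            2%:C *: ((c ** c) ** (c ** c)).
    by rewrite -[2]/(1 + 1) scaleRD scale1R.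
  rewrite (cnormR hN) ger0_norm// (cnorm_sa hN)// Ncc.
  have s20 : 0 < s ^+ 2 by rewrite exprn_gt0.
  lra.
apply: pos_mono; first by apply: posD; exists (c ** c).
rewrite opprD addrACA subrr addr0.
rewrite -mul_scalar -smulBr; apply: posM => //.
  by apply: sa_le_norm => //; rewrite Ncc.
by rewrite smulBl smulBr scalar_mul mul_scalar.
Qed.

(** With [k] the absolute value of [h], the difference [d = k - h] is twice the negative part of
    [h]. Since [h ** d = - (k ** d)], the product [x ** d] satisfies the hypothesis of
    [star_smul_neg_sq] and vanishes, which forces [d = 0]. *)
Lemma pos_star_smul x : pos (star x ** x).
Proof.
set h := star x ** x; have hsa : star h = h by rewrite starM starK.
have [|k [kpos kk hk]] := @pos_sqrt (h ** h); first by exists h.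
have {}hk : h ** k = k ** h by apply: hk; rewrite smulA.
have [w [/pos_sa wsa ww wx]] := pos_sqrt kpos.
pose d := k - h; have dsa : star d = d by rewrite starB hsa (pos_sa kpos).
have hw : h ** w = w ** h by exact: wx.
have kw : k ** w = w ** k by exact: wx.
have dw : d ** w = w ** d by rewrite smulBl smulBr hw kw.
have hd : h ** d = - (k ** d).
  by rewrite !smulBr kk hk opprB addrC.
have xd0 : x ** d = 0.
  apply: (@star_smul_neg_sq _ (d ** w)); first by rewrite starM dsa wsa dw.
  rewrite starM dsa -smulA (smulA (star x)) -/h hd smulNr -ww; congr (- _).
  by rewrite -(smulA w) -dw !smulA.
have kd0 : k ** d = 0.
  by apply: oppr_inj; rewrite -hd oppr0 /h -smulA xd0 smul0r.
have dd0 : d ** d = 0.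
  by rewrite {1}/d smulBl hd kd0 oppr0 subr0.
have /eqP : d = 0 by apply: (star_smul_eq0 hN); rewrite dsa.
by rewrite subr_eq0 => /eqP <-.
Qed.

Lemma pos_conj p x : pos p -> pos (star x ** p ** x).
Proof.
move=> [b bsa ->]; have -> : star x ** (b ** b) ** x = star (b ** x) ** (b ** x).
  by rewrite starM bsa !smulA.
exact: pos_star_smul.
Qed.

Lemma pos_antisym p : pos p -> pos (- p) -> p = 0.
Proof.
move=> ppos npos; apply: (cnorm_le0 hN); rewrite -(cnorm0 hN).
by apply: pos_mono; rewrite ?sub0r.
Qed.

(** Any positive root [t] is compared with the constructed root [q], which commutes with it. For
    [d = q - t] the positive elements [d ** q ** d] and [d ** t ** d] add up to zero, so both
    vanish; their difference is the cube of [d]. *)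
Lemma pos_sqrt_unique (r s : A) : pos r -> pos s -> r ** r = s ** s -> r = s.
Proof.
move=> rpos spos rs; have [q [qpos qq qx]] : exists s', [/\ pos s', s' ** s' = r ** r
    & forall x, x ** (r ** r) = (r ** r) ** x -> x ** s' = s' ** x].
  by apply: pos_sqrt; exists r; rewrite ?pos_sa.
suff eq_q (t : A) : pos t -> t ** t = r ** r -> t = q by rewrite (eq_q r)// (eq_q s).
move=> tpos tt; have tq : t ** q = q ** t by apply: qx; rewrite -tt smulA.
pose d := q - t; have dsa : star d = d by rewrite starB !pos_sa.
have sum0 : d ** q ** d + d ** t ** d = 0.
  rewrite -smulDl -smulDr -smulA.
  have -> : (q + t) ** d = (q ** q - t ** t) + (t ** q - q ** t) by rewrite /d; ncring.
  by rewrite tq subrr addr0 qq tt subrr smul0r.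
have pos_d p : pos p -> pos (d ** p ** d) by move/(pos_conj d); rewrite dsa.
have q0 : d ** q ** d = 0.
  apply: pos_antisym; first exact: pos_d.
  have -> : - (d ** q ** d) = d ** t ** d by rewrite -[LHS]addr0 -sum0 addKr.
  exact: pos_d.
have t0 : d ** t ** d = 0 by move: sum0; rewrite q0 add0r.
have ddd : d ** d ** d = 0 by rewrite {2}/d smulBr smulBl q0 t0 subrr.
have dd : d ** d = 0.
  by apply: (star_smul_eq0 hN); rewrite starM dsa smulA ddd smul0l.
have /eqP : d = 0 by apply: (star_smul_eq0 hN); rewrite dsa.
by rewrite subr_eq0 => /eqP.
Qed.

Lemma pos_lim (u : nat -> A) x : cvg_for N u x -> (forall k, pos (u k)) -> pos x.
Proof.
move=> ux upos; have [M HM] := cvg_for_bounded hN ux.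
have M0 : 0 < M + 1.
  by rewrite ltr_wpDl// (le_trans (cnorm_ge0 hN _) (HM 0%N)).
apply: (@pos_of_near_scalar _ (M + 1)) => //.
  apply: (cvg_for_unique hN _ ux); have := cvg_for_star hN ux.
  by under eq_fun do rewrite pos_sa//.
apply: (cvg_for_le hN (cvg_forB hN (cvg_for_cst hN _) ux)) => k.
by apply: pos_near_scalar => //; rewrite (le_trans (HM k))// lerDl.
Qed.

(* The resolvent is the limit of the Neumann iteration [w |-> e + q ** w]
   with [q = (t e - a) / (1 + t)], whose norm is at most [t / (1 + t) < 1]. *)
Lemma pos_resolvent a : pos a ->
  exists g, [/\ star g = g, (e + a) ** g = e, g ** (e + a) = e &
    N (g ** a ** g) <= 4^-1].
Proof.
move=> apos; set t := N a + 1; have t0 : 0 < t := norm1_gt0 a.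
have t1 : 0 < 1 + t by rewrite addr_gt0.
pose q := (1 + t)^-1%:C *: (t%:C *: e - a).
have qsa : star q = q by rewrite starZ_real starB star_scalar (pos_sa apos).
pose th := t / (1 + t).
have th0 : 0 <= th by rewrite divr_ge0 ?ltW.
have th1 : 1 - th = (1 + t)^-1 by rewrite /th; field; rewrite gt_eqF.
have Nq : N q <= th.
  rewrite (cnormR hN) gtr0_norm ?invr_gt0// /th mulrC ler_pM2r ?invr_gt0//.
  by apply: pos_near_scalar; rewrite ?norm1_ge.
pose w := fix w (k : nat) : A := if k is k'.+1 then e + q ** w k' else 0.
(* The majorant increases towards [1 + t], the fixed point of its recursion, because [1 - th] is the
   inverse of [1 + t]. *)
pose v := fix v (k : nat) : R := if k is k'.+1 then 1 + th * v k' else 0.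
have wq k : q ** w k = w k ** q.
  elim: k => [|k IH] /=; first by rewrite smul0l smul0r.
  by rewrite smulDl smulDr mul1a mula1 -smulA IH.
have wsa k : star (w k) = w k.
  by elim: k => [|k IH] /=; rewrite ?star0// starD star_unit starM IH qsa wq.
have [l wl] : exists l, cvg_for N w l.
  apply: (cvg_for_dominated hN (v := v) (M := 1 + t)).
    elim=> [|k IH]; first by rewrite /= smul0r mulr0 !addr0 !subr0 cnorm_unit_le1.
    rewrite [w k.+2]/= [v k.+2]/= [X in N (_ - X)]/= [X in _ <= _ - X]/=.
    rewrite opprD addrACA subrr add0r -smulBr opprD addrACA subrr add0r -mulrBr.
    by rewrite (le_trans (cnorm_submul hN _ _))// ler_pM ?(cnorm_ge0 hN).
  elim=> [|k IH] /=; first exact: ltW.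
  rewrite (le_trans (y := 1 + th * (1 + t)))// ?lerD2l ?ler_wpM2l//.
  by rewrite /th divfK ?gt_eqF.
have lE : l = e + q ** l.
  apply: (cvg_for_unique hN (cvg_for_shift wl)).
  by apply: (cvg_forD hN); [exact: cvg_for_cst|exact: cvg_forMl].
have lsa : star l = l.
  apply: (cvg_for_unique hN _ wl); have := cvg_for_star hN wl.
  by under eq_fun do rewrite wsa.
pose g := (1 + t)^-1%:C *: l.
have gsa : star g = g by rewrite starZ_real lsa.
have ag : (e + a) ** g = e.
  have eaE : e + a = (1 + t)%:C *: (e - q).
    rewrite scalerBr scaleRA divff ?gt_eqF// scale1R scaleRD scale1R.
    by ncring.
  rewrite eaE smulZl smulZr scaleRA divff ?gt_eqF// scale1R.
  by rewrite smulBl mul1a {1}lE addrK.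
have ga : g ** (e + a) = e.
  by have := congr1 star ag; rewrite starM gsa starD star_unit (pos_sa apos).
exists g; split => //.
have gaE : g ** a = e - g by rewrite -[X in X - g]ga; ncring.
have gag : pos (g ** a ** g) by have := pos_conj g apos; rewrite gsa.
(* As [g ** a ** g = g - g ** g], subtracting it from 1/4 leaves the square of [1/2 - g]; hence the
   constant. *)
apply: pos_le_norm => //; exists (2^-1%:C *: e - g).
  by rewrite starB star_scalar gsa.
have -> : (2^-1%:C *: e - g) ** (2^-1%:C *: e - g) =
    2^-1%:C *: (2^-1%:C *: e) - (2^-1%:C *: g + 2^-1%:C *: g) + g ** g.
  by rewrite smulBl !smulBr !scalar_mul mul_scalar; ncring.
rewrite -scalerDr halfZ_double scaleRA gaE.
have -> : 2^-1 * 2^-1 = 4^-1 :> R by field.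
by ncring.
Qed.

End Unital.

Lemma real_complete (R : realType) (u : nat -> R) :
  cauchy_for (fun x => `|x|) u -> exists l, cvg_for (fun x => `|x|) u l.
Proof.
move=> cu; have : cvgn u.
  apply/cauchy_cvgP/cauchy_exP => eps eps0; have [K HK] := cu _ eps0.
  by exists (u K), K => // k /= Kk; exact: HK.
move=> /cvgrPdist_lt uc; exists (limn u).
apply/cvg_forP => [x|e e0]; first exact: normr_ge0.
by have [K _ HK] := uc _ e0; exists K => k Kk; rewrite distrC; exact: HK.
Qed.

(** * Operator norms and unitization *)

Section ComplexNorm.
Variable R : realType.
Implicit Types (z : R[i]) (r : R).

Definition absC z : R := complex.Re `|z|.

Lemma absCE z : (absC z)%:C = `|z|.
Proof. by rewrite /absC RRe_real// normr_real. Qed.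

Lemma absC_ge0 z : 0 <= absC z. Proof. by rewrite -ler0c absCE. Qed.

Lemma absC0 : absC 0 = 0. Proof. by rewrite /absC normr0. Qed.

Lemma absC1 : absC 1 = 1. Proof. by rewrite /absC normr1. Qed.

Lemma absC_eq0 z : absC z = 0 -> z = 0.
Proof. by move=> z0; apply/normr0_eq0; rewrite -absCE z0. Qed.

Lemma absCM z1 z2 : absC (z1 * z2) = absC z1 * absC z2.
Proof. by apply: (@complexI R); rewrite rmorphM /= !absCE normrM. Qed.

Lemma absCD z1 z2 : absC (z1 + z2) <= absC z1 + absC z2.
Proof. by rewrite -lecR rmorphD /= !absCE ler_normD. Qed.

Lemma absCJ z : absC (z^*)%R = absC z.
Proof. by rewrite /absC norm_conjC. Qed.

Lemma absC_def z : absC z = Num.sqrt (complex.Re z ^+ 2 + complex.Im z ^+ 2).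
Proof. by rewrite /absC normc_def. Qed.

Lemma absC_real r : absC r%:C = `|r|.
Proof. by rewrite absC_def /= expr0n /= addr0 sqrtr_sqr. Qed.

Lemma absC_geRe z : `|complex.Re z| <= absC z.
Proof. by rewrite absC_def -sqrtr_sqr ler_wsqrtr// lerDl sqr_ge0. Qed.

Lemma absC_geIm z : `|complex.Im z| <= absC z.
Proof. by rewrite absC_def -sqrtr_sqr ler_wsqrtr// lerDr sqr_ge0. Qed.

Lemma absC_le z : absC z <= `|complex.Re z| + `|complex.Im z|.
Proof.
have H : 0 <= `|complex.Re z| + `|complex.Im z| by rewrite addr_ge0.
rewrite absC_def -[leRHS]ger0_norm// -sqrtr_sqr ler_wsqrtr//.
rewrite sqrrD !real_normK ?num_real// addrAC lerDl.
by rewrite mulrn_wge0// mulr_ge0.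
Qed.

Lemma absC_complete (l : nat -> R[i]) :
  cauchy_for absC l -> exists z, cvg_for absC l z.
Proof.
move=> lc; have comp (f : R[i] -> R) : (forall z, `|f z| <= absC z) ->
    (forall x y, f (x - y) = f x - f y) -> exists y, cvg_for (fun x => `|x|) (f \o l) y.
  move=> fle fB; apply: real_complete => e /lc[K HK].
  by exists K => p q Kp Kq; rewrite /= -fB (le_lt_trans (fle _))// HK.
have [||x xl] := comp (@complex.Re R); first exact: absC_geRe.
  by move=> [? ?] [? ?].
have [||y yl] := comp (@complex.Im R); first exact: absC_geIm.
  by move=> [? ?] [? ?].
exists (x +i* y); apply/(cvg_forP absC_ge0) => e e0.
have e2 : 0 < e / 2 by rewrite divr_gt0.
move/(cvg_forP (@normr_ge0 _ R))/(_ _ e2) : xl => [K HK].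
move/(cvg_forP (@normr_ge0 _ R))/(_ _ e2) : yl => [L HL].
exists (maxn K L) => k; rewrite geq_max => /andP[Kk Lk].
rewrite (le_lt_trans (absC_le _))// [ltRHS]splitr ltrD//.
  by have := HK _ Kk; rewrite /=; case: (l k).
by have := HL _ Lk; rewrite /=; case: (l k).
Qed.

End ComplexNorm.

Arguments absC {R} z.

(* [E] acts on [X] with adjoints; [operator_adj] is what the Cauchy-Schwarz
   inequality [|Tx|^2 = |<x, T^*Tx>| <= |x| |T^*Tx|] leaves of the inner product. *)
Section OperatorNorm.
Variables (R : realType) (E : starAlgType R) (X : Type).
Variables (nx : X -> R) (act : E -> X -> X) (x0 : X) (dil : R -> X -> X).
Hypotheses (nx_ge0 : forall x, 0 <= nx x) (nx_x0 : nx x0 <= 1).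
Hypothesis nx_dil : forall r x, 0 <= r -> nx (dil r x) = r * nx x.
Hypothesis act_dil : forall r T x, 0 <= r -> nx (act T (dil r x)) = r * nx (act T x).
Hypothesis operator_bounded :
  forall T, exists2 M, 0 <= M & forall x, nx (act T x) <= M * nx x.
Hypothesis act_add :
  forall S T x, nx (act (S + T) x) <= nx (act S x) + nx (act T x).
Hypothesis act_scale :
  forall c T x, nx (act (c *: T) x) = absC c * nx (act T x).
Hypothesis act_mul : forall S T x, act (S ** T) x = act S (act T x).
Hypothesis operator_adj :
  forall T x, nx (act T x) ^+ 2 <= nx x * nx (act (star T ** T) x).

Definition operator_norm (T : E) : R :=
  sup [set nx (act T x) | x in [set x | nx x <= 1]].

Lemma operator_norm_le T M :
  0 <= M -> (forall x, nx (act T x) <= M * nx x) -> operator_norm T <= M.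
Proof.
move=> M0 TM; apply: ge_sup; first by exists (nx (act T x0)), x0.
by move=> _ [x /= x1 <-]; rewrite (le_trans (TM x))// ler_piMr.
Qed.

Lemma operator_norm_ub T x : nx (act T x) <= operator_norm T * nx x.
Proof.
have [M M0 TM] := operator_bounded T.
have [x_eq0|nx0] := eqVneq (nx x) 0.
  by rewrite x_eq0 mulr0 (le_trans (TM x))// x_eq0 mulr0.
have x_gt0 : 0 < nx x by rewrite lt_neqAle eq_sym nx0 nx_ge0.
have xV : 0 <= (nx x)^-1 by rewrite invr_ge0.
rewrite -ler_pdivrMr// mulrC -act_dil//; apply: ub_le_sup.
  by exists M => _ [y /= y1 <-]; rewrite (le_trans (TM y))// ler_piMr.
by exists (dil (nx x)^-1 x) => //=; rewrite nx_dil// mulVf.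
Qed.

Lemma operator_norm_ge0 T : 0 <= operator_norm T.
Proof.
have [M M0 TM] := operator_bounded T.
apply: (le_trans (nx_ge0 (act T x0))); apply: ub_le_sup; last by exists x0.
by exists M => _ [y /= y1 <-]; rewrite (le_trans (TM y))// ler_piMr.
Qed.

Lemma operator_normD S T :
  operator_norm (S + T) <= operator_norm S + operator_norm T.
Proof.
apply: operator_norm_le => [|x]; first by rewrite addr_ge0 ?operator_norm_ge0.
by rewrite (le_trans (act_add _ _ _))// mulrDl lerD ?operator_norm_ub.
Qed.

Lemma operator_normZ c T : operator_norm (c *: T) = absC c * operator_norm T.
Proof.
have le c' T' : operator_norm (c' *: T') <= absC c' * operator_norm T'.
  apply: operator_norm_le => [|x]; first by rewrite mulr_ge0 ?absC_ge0 ?operator_norm_ge0.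
  by rewrite act_scale -mulrA ler_wpM2l ?absC_ge0 ?operator_norm_ub.
have [->|c0] := eqVneq c 0.
  by apply/le_anti; rewrite {1}le absC0 mul0r operator_norm_ge0.
apply/le_anti; rewrite le /=.
have cpos : 0 < absC c.
  rewrite lt_neqAle absC_ge0 andbT eq_sym; apply: contra c0.
  by move=> /eqP/absC_eq0 ->.
have cV : absC c^-1 = (absC c)^-1.
  by apply: (mulfI (lt0r_neq0 cpos)); rewrite -absCM divff// absC1 divff// lt0r_neq0.
rewrite -ler_pdivlMl// -cV (le_trans _ (le c^-1 (c *: T)))//.
by rewrite scalerA mulVf// scale1r.
Qed.

Lemma operator_normM S T :
  operator_norm (S ** T) <= operator_norm S * operator_norm T.
Proof.
apply: operator_norm_le => [|x]; first by rewrite mulr_ge0 ?operator_norm_ge0.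
rewrite act_mul (le_trans (operator_norm_ub _ _))// -mulrA.
by rewrite ler_wpM2l ?operator_norm_ge0 ?operator_norm_ub.
Qed.

(** [operator_adj] bounds the square of the norm of [T] by that of [star T ** T]. With
    submultiplicativity this makes the star isometric, and the reverse inequality follows. *)
Lemma operator_norm_cstar T : operator_norm (star T ** T) = operator_norm T ^+ 2.
Proof.
have sq_le S : operator_norm S ^+ 2 <= operator_norm (star S ** S).
  have n0 := operator_norm_ge0 (star S ** S).
  rewrite -[leRHS]sqr_sqrtr// ler_pXn2r ?nnegrE ?sqrtr_ge0 ?operator_norm_ge0//.
  apply: operator_norm_le; first exact: sqrtr_ge0.
  move=> x; rewrite -(@ler_pXn2r _ 2)// ?nnegrE ?mulr_ge0 ?sqrtr_ge0//.
  rewrite exprMn sqr_sqrtr// (le_trans (operator_adj _ _))// expr2 mulrCA.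
  by rewrite ler_wpM2l// operator_norm_ub.
have star_le S : operator_norm S <= operator_norm (star S).
  have [->|S0] := eqVneq (operator_norm S) 0; first exact: operator_norm_ge0.
  have S_gt0 : 0 < operator_norm S by rewrite lt_neqAle eq_sym S0 operator_norm_ge0.
  by rewrite -(ler_pM2r S_gt0) -expr2 (le_trans (sq_le S))// operator_normM.
have starE : operator_norm (star T) = operator_norm T.
  by apply/le_anti; rewrite star_le -{2}(starK T) star_le.
apply/le_anti; rewrite sq_le andbT (le_trans (operator_normM _ _))//.
by rewrite starE expr2.
Qed.

End OperatorNorm.

(** * The unitization and its C*-norm *)

Definition unitize (R : realType) (A : starAlgType R) : Type := (A * R[i])%type.

Section Unitization.
Variables (R : realType) (A : starAlgType R).
Local Notation U := (unitize A).
Implicit Types (S T : U) (a b : A) (l m : R[i]).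

HB.instance Definition _ := GRing.Lmodule.copy U (A * (R[i])^o)%type.

Definition unit_mul S T : U := (S.1 ** T.1 + S.2 *: T.1 + T.2 *: S.1, S.2 * T.2).
Definition unit_star T : U := (star T.1, (T.2)^*%R).

Lemma unit_eq S T : S.1 = T.1 -> S.2 = T.2 -> S = T.
Proof. by case: S T => [? ?] [? ?] /= -> ->. Qed.

Lemma unit_mulA : associative unit_mul.
Proof.
move=> [a l] [b m] [c k]; apply: unit_eq => /=; last exact: mulrA.
rewrite !(smulDl, smulDr, scalerDr, smulZl, smulZr, scalerA, smulA) !addrA.
by rewrite [LHS](ACl (1*4*2*5*3*6*7)) [l * k]mulrC [m * k]mulrC.
Qed.

Lemma unit_mulDl : left_distributive unit_mul +%R.
Proof.
move=> [a l] [b m] [c k]; apply: unit_eq => /=; last exact: mulrDl.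
by rewrite smulDl scalerDl scalerDr !addrA [LHS](ACl (1*3*5*2*4*6)).
Qed.

Lemma unit_mulDr : right_distributive unit_mul +%R.
Proof.
move=> [a l] [b m] [c k]; apply: unit_eq => /=; last exact: mulrDr.
by rewrite smulDr scalerDl scalerDr !addrA [LHS](ACl (1*3*5*2*4*6)).
Qed.

Lemma unit_mulZl l S T : unit_mul (l *: S) T = l *: unit_mul S T.
Proof.
apply: unit_eq => /=; last by rewrite -mulrA.
by rewrite smulZl !scalerDr !scalerA [T.2 * l]mulrC.
Qed.

Lemma unit_mulZr l S T : unit_mul S (l *: T) = l *: unit_mul S T.
Proof.
apply: unit_eq => /=; last by rewrite mulrCA.
by rewrite smulZr !scalerDr !scalerA [S.2 * l]mulrC.
Qed.

Lemma unit_starK : involutive unit_star.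
Proof. by move=> [a l]; rewrite /unit_star /= starK conjCK. Qed.

Lemma unit_starD : {morph unit_star : S T / S + T}.
Proof. by move=> [a l] [b m]; apply: unit_eq => /=; rewrite ?starD ?rmorphD. Qed.

Lemma unit_starZ l T : unit_star (l *: T) = (l^*)%R *: unit_star T.
Proof. by apply: unit_eq => /=; rewrite ?starZ ?rmorphM. Qed.

Lemma unit_starM S T : unit_star (unit_mul S T) = unit_mul (unit_star T) (unit_star S).
Proof.
apply: unit_eq => /=; last by rewrite rmorphM mulrC.
by rewrite !starD !starZ starM addrAC.
Qed.

HB.instance Definition _ := Lmodule_isStarAlgebra.Build R U
  unit_mulA unit_mulDl unit_mulDr unit_mulZl unit_mulZr
  unit_starK unit_starD unit_starZ unit_starM.

Definition unit_one : U := (0, 1).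
Definition unit_emb a : U := (a, 0).

Lemma unit_mul1a : left_id unit_one (@smul R U).
Proof.
move=> [a l]; apply: unit_eq => /=; last by rewrite mul1r.
by rewrite smul0l scaler0 addr0 add0r scale1r.
Qed.

Lemma unit_mula1 : right_id unit_one (@smul R U).
Proof.
move=> [a l]; apply: unit_eq => /=; last by rewrite mulr1.
by rewrite smul0r scaler0 addr0 add0r scale1r.
Qed.

Lemma unit_embD a b : unit_emb (a + b) = unit_emb a + unit_emb b.
Proof. by apply: unit_eq => //=; rewrite addr0. Qed.

Lemma unit_embN a : unit_emb (- a) = - unit_emb a.
Proof. by apply: unit_eq => //=; rewrite oppr0. Qed.

Lemma unit_embB a b : unit_emb (a - b) = unit_emb a - unit_emb b.
Proof. by rewrite unit_embD unit_embN. Qed.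

Lemma unit_embZ l a : unit_emb (l *: a) = l *: unit_emb a.
Proof. by apply: unit_eq => //=; rewrite scaler0. Qed.

Lemma unit_embM a b : unit_emb (a ** b) = unit_emb a ** unit_emb b.
Proof. by apply: unit_eq => /=; rewrite ?mul0r// !scale0r !addr0. Qed.

Lemma unit_emb_star a : unit_emb (star a) = star (unit_emb a).
Proof. by apply: unit_eq => //=; rewrite rmorph0. Qed.

Lemma unit_emb_inj a b : unit_emb a = unit_emb b -> a = b.
Proof. by case. Qed.

Variable N : A -> R.
Hypothesis hN : cstar_norm N.

Let nx (x : U) : R := Num.max (N x.1) (absC x.2).
Let act (T x : U) : U := (T.1 ** x.1 + T.2 *: x.1, T.2 * x.2).

(** Left multiplication on [A] alone would be degenerate: if [A] has a unit [1], the pair [(1, -1)]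
    acts on it as zero. The second coordinate of the space records the character [T.2] and makes the
    norm definite. *)
Definition unit_norm : U -> R := operator_norm nx act.

Let nx_ge0 x : 0 <= nx x.
Proof. by rewrite le_max (cnorm_ge0 hN). Qed.

Let nx0 : nx 0 <= 1.
Proof. by rewrite /nx /= absC0 (cnorm0 hN) maxxx ler01. Qed.

Let dil (r : R) (x : U) : U := r%:C *: x.

Let nx_dil r x : 0 <= r -> nx (dil r x) = r * nx x.
Proof.
by move=> r0; rewrite /nx /= (cnormR hN) absCM absC_real ger0_norm// maxr_pMr.
Qed.

Let act_dil r T x : 0 <= r -> nx (act T (dil r x)) = r * nx (act T x).
Proof.
move=> r0; rewrite -nx_dil//; congr nx; apply: unit_eq => /=; last by rewrite mulrCA.
by rewrite smulZr scalerDr !scalerA [T.2 * _]mulrC.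
Qed.

Let nx_fst x : N x.1 <= nx x. Proof. by rewrite le_max lexx. Qed.
Let nx_snd x : absC x.2 <= nx x. Proof. by rewrite le_max lexx orbT. Qed.

Let act_norm T x : nx (act T x) <= (N T.1 + absC T.2) * nx x.
Proof.
have N0 := cnorm_ge0 hN T.1; have C0 := absC_ge0 T.2.
rewrite ge_max; apply/andP; split => /=.
  rewrite (le_trans (cnorm_triangle hN _ _))// mulrDl lerD//.
    by rewrite (le_trans (cnorm_submul hN _ _))// ler_wpM2l.
  by rewrite (cnormZ hN) ler_wpM2l.
by rewrite absCM mulrDl -[leLHS]add0r lerD ?mulr_ge0// ler_wpM2l.
Qed.

Let act_bounded T : exists2 M, 0 <= M & forall x, nx (act T x) <= M * nx x.
Proof.
exists (N T.1 + absC T.2); last exact: act_norm.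
by rewrite addr_ge0 ?absC_ge0 ?(cnorm_ge0 hN).
Qed.

Let act_add S T x : nx (act (S + T) x) <= nx (act S x) + nx (act T x).
Proof.
rewrite ge_max; apply/andP; split => /=.
  rewrite smulDl scalerDl addrACA (le_trans (cnorm_triangle hN _ _))//.
  by apply: lerD; exact: (nx_fst (act _ x)).
rewrite mulrDl (le_trans (absCD _ _))//.
by apply: lerD; exact: (nx_snd (act _ x)).
Qed.

Let act_scale c T x : nx (act (c *: T) x) = absC c * nx (act T x).
Proof.
rewrite /nx /= -mulrA absCM smulZl -scalerA -scalerDr (cnormZ hN).
by rewrite maxr_pMr ?absC_ge0.
Qed.

Let act_mul S T x : act (S ** T) x = act S (act T x).
Proof.
apply: unit_eq => /=; last by rewrite mulrA.
rewrite !(smulDl, smulDr, scalerDr, smulZl, smulZr, scalerA, smulA) !addrA.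
by rewrite [LHS](ACl (1*3*2*4)).
Qed.

Let act_adj T x : nx (act T x) ^+ 2 <= nx x * nx (act (star T ** T) x).
Proof.
have sq_max (p q : R) : 0 <= p -> 0 <= q -> Num.max p q ^+ 2 = Num.max (p ^+ 2) (q ^+ 2).
  move=> p0 q0; rewrite !maxEle ler_pXn2r ?nnegrE//.
  by case: ifP.
rewrite sq_max ?(cnorm_ge0 hN) ?absC_ge0// ge_max; apply/andP; split.
  rewrite -(cnorm_cstar hN) (le_trans _ (ler_pM _ _ (nx_fst _) (nx_fst _)))//.
  - rewrite act_mul -(cnorm_star hN x.1).
    rewrite (le_trans _ (cnorm_submul hN _ _))//= le_eqVlt; apply/orP; left.
    apply/eqP; congr N.
    by rewrite starD starM starZ smulDl smulZl [RHS]smulDr smulZr [in RHS]smulA.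
  - exact: (cnorm_ge0 hN).
  - exact: (cnorm_ge0 hN).
rewrite (le_trans _ (ler_pM _ _ (nx_snd _) (nx_snd _))) ?absC_ge0//=.
by rewrite !absCM absCJ le_eqVlt; apply/orP; left; apply/eqP; ring.
Qed.

Let opD := operator_normD nx_ge0 nx0 nx_dil act_dil act_bounded act_add.
Let opub := operator_norm_ub nx_ge0 nx_dil act_dil act_bounded.

Lemma unit_norm_ge_snd T : absC T.2 <= unit_norm T.
Proof.
have := opub T (0, 1); rewrite /nx /act /= smul0r scaler0 addr0 mulr1 (cnorm0 hN).
by rewrite absC1 !max_r ?ler01 ?absC_ge0// mulr1.
Qed.

Lemma unit_norm_scalar l : unit_norm (0, l) <= absC l.
Proof.
apply: (operator_norm_le nx0); first exact: absC_ge0.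
by move=> x; rewrite (le_trans (act_norm _ _))//= (cnorm0 hN) add0r.
Qed.

Lemma unit_norm_emb a : unit_norm (unit_emb a) = N a.
Proof.
apply/le_anti/andP; split.
  apply: (operator_norm_le nx0); first exact: (cnorm_ge0 hN).
  by move=> x; rewrite (le_trans (act_norm _ _))//= absC0 addr0.
have [->|Na0] := eqVneq (N a) 0.
  by rewrite (le_trans _ (unit_norm_ge_snd _))//= absC0.
have Na : 0 < N a by rewrite lt_neqAle eq_sym Na0 (cnorm_ge0 hN).
rewrite -(ler_pM2r Na) -expr2 -(cnorm_cstar' hN).
have nxs : nx (star a, 0) = N a.
  by rewrite /nx /= absC0 (cnorm_star hN) max_l ?(ltW Na).
have := opub (unit_emb a) (star a, 0); rewrite nxs.
by apply: le_trans; rewrite /act /= scale0r addr0; exact: (nx_fst (_, _)).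
Qed.

Lemma unit_norm_cstar : cstar_norm unit_norm.
Proof.
have split_unit T : T = unit_emb T.1 + (0, T.2).
  by apply: unit_eq => /=; rewrite ?addr0 ?add0r.
have nD S T : unit_norm (S + T) <= unit_norm S + unit_norm T := opD S T.
split.
- exact: nD.
- exact: (operator_normZ nx_ge0 nx0 nx_dil act_dil act_bounded act_scale).
- move=> T T0.
  have T2 : T.2 = 0.
    by apply: absC_eq0; apply/le_anti; rewrite absC_ge0 -T0 unit_norm_ge_snd.
  have T1 : T = unit_emb T.1 by apply: unit_eq.
  by rewrite T1; congr unit_emb; apply: (cnorm_eq0 hN); rewrite -unit_norm_emb -T1.
- exact: (operator_normM nx_ge0 nx0 nx_dil act_dil act_bounded act_mul).
- exact: (operator_norm_cstar nx_ge0 nx0 nx_dil act_dil act_bounded act_mul act_adj).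
move=> u uc.
have [l ul] : exists l, cvg_for absC (fun k => (u k).2) l.
  apply: absC_complete => e /uc[K HK]; exists K => p q Kp Kq.
  by rewrite (le_lt_trans _ (HK p q Kp Kq))//; exact: (unit_norm_ge_snd (u p - u q)).
have [a ua] : exists a, cvg_for N (fun k => (u k).1) a.
  apply: (cnorm_complete hN) => e e0.
  (* The first coordinate of [u p - u q] is that element minus a scalar of no larger norm, so each
     of the two gets half of [e]. *)
  have [K HK] := uc _ (divr_gt0 e0 (ltr0Sn R 1)).
  exists K => p q Kp Kq; rewrite -unit_norm_emb.
  have -> : unit_emb ((u p).1 - (u q).1) = (u p - u q) + (0, - (u p - u q).2).
    by apply: unit_eq => /=; rewrite ?addr0 ?subrr.
  rewrite (le_lt_trans (nD _ _))// [ltRHS]splitr ltrD ?HK//.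
  rewrite (le_lt_trans (unit_norm_scalar _))// (le_lt_trans _ (HK p q Kp Kq))//.
  rewrite /absC normrN -/(absC _); exact: unit_norm_ge_snd.
exists (a, l).
have n0 x : 0 <= unit_norm x by rewrite (le_trans _ (unit_norm_ge_snd _))// absC_ge0.
apply: (@squeeze_cvgr _ _ _ _ (fun=> 0) (fun k => N ((u k).1 - a) + absC ((u k).2 - l))).
- near=> k; rewrite n0 /= (split_unit (u k - (a, l))) (le_trans (nD _ _))//.
  by rewrite lerD ?unit_norm_scalar//= unit_norm_emb.
- exact: cvg_cst.
- by rewrite -[X in _ --> X]addr0; exact: cvgD.
Unshelve. all: by end_near.
Qed.

End Unitization.

(** * Star homomorphisms and positivity without unit *)

Section StarHom.
Variables (R : realType) (A C : starAlgType R) (f : A -> C).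
Hypothesis hf : star_hom f.
Implicit Types x y : A.

Lemma star_homD x y : f (x + y) = f x + f y.
Proof. by case: hf => fl _ _; have := fl 1 x y; rewrite !scale1r. Qed.

Lemma star_hom0 : f 0 = 0.
Proof. by apply: (addrI (f 0)); rewrite -star_homD !addr0. Qed.

Lemma star_homZ c x : f (c *: x) = c *: f x.
Proof. by case: hf => fl _ _; have := fl c x 0; rewrite star_hom0 !addr0. Qed.

Lemma star_homN x : f (- x) = - f x.
Proof. by rewrite -scaleN1r star_homZ scaleN1r. Qed.

Lemma star_homB x y : f (x - y) = f x - f y.
Proof. by rewrite star_homD star_homN. Qed.

Lemma star_homM x y : f (x ** y) = f x ** f y.
Proof. by case: hf. Qed.

Lemma star_homS x : f (star x) = star (f x).
Proof. by case: hf. Qed.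

Lemma star_hom_sum (I : Type) (s : seq I) (P : pred I) (F : I -> A) :
  f (\sum_(i <- s | P i) F i) = \sum_(i <- s | P i) f (F i).
Proof. exact: (big_morph f star_homD star_hom0). Qed.

Lemma star_hom_pos x : pos x -> pos (f x).
Proof. by move=> [b bsa ->]; exists (f b); rewrite ?star_homM// -star_homS bsa. Qed.

Lemma star_hom_unitize : star_hom (fun T : unitize A => (f T.1, T.2) : unitize C).
Proof.
split.
- by move=> c S T; apply: unit_eq; rewrite //= star_homD star_homZ.
- by move=> S T; apply: unit_eq; rewrite //= !star_homD !star_homZ star_homM.
- by move=> T; apply: unit_eq; rewrite //= star_homS.
Qed.

End StarHom.

Section CstarPositive.
Variables (R : realType) (A : starAlgType R) (N : A -> R).
Hypothesis hN : cstar_norm N.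
Implicit Types (a b p q x y z : A).

Let hU := unit_norm_cstar hN.
Let e := unit_one A.
Let el := @unit_mul1a R A.
Let er := @unit_mula1 R A.

Lemma unit_emb_fst (T : unitize A) : T.2 = 0 -> T = unit_emb T.1.
Proof. by move=> T2; apply: unit_eq. Qed.

(** Squaring squares the scalar part, so a root in the unitization of an element of [A] has scalar
    part zero and already lies in [A]. Through this the order theory of unital algebras passes to
    all algebras. *)
Lemma unit_emb_pos a : pos (unit_emb a) <-> pos a.
Proof.
split=> [[T Tsa aE]|[b bsa ->]]; last first.
  by exists (unit_emb b); rewrite -?unit_emb_star ?unit_embM ?bsa.
have T2 : T.2 = 0.
  by have := congr1 snd aE; rewrite /= => /esym/eqP; rewrite mulf_eq0 orbb => /eqP.
rewrite (unit_emb_fst T2) in Tsa aE.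
exists T.1; apply: unit_emb_inj; first by rewrite unit_emb_star.
by rewrite unit_embM.
Qed.

Lemma cstar_posD a b : pos a -> pos b -> pos (a + b).
Proof.
move=> /unit_emb_pos pa /unit_emb_pos pb; apply/unit_emb_pos.
by rewrite unit_embD; exact: (posD hU el er).
Qed.

Lemma cstar_posM a b : pos a -> pos b -> a ** b = b ** a -> pos (a ** b).
Proof.
move=> /unit_emb_pos pa /unit_emb_pos pb ab; apply/unit_emb_pos.
by rewrite unit_embM; apply: (posM hU el er) => //; rewrite -!unit_embM ab.
Qed.

Lemma cstar_pos_mono p q : pos p -> pos (q - p) -> N p <= N q.
Proof.
move=> /unit_emb_pos pp /unit_emb_pos; rewrite unit_embB => pqp.
by rewrite -!(unit_norm_emb hN); exact: (pos_mono hU el er).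
Qed.

Lemma cstar_pos_star_smul x : pos (star x ** x).
Proof.
by apply/unit_emb_pos; rewrite unit_embM unit_emb_star; exact: (pos_star_smul hU el er).
Qed.

Lemma cstar_pos_smul_star x : pos (x ** star x).
Proof. by rewrite -{1}(starK x); exact: cstar_pos_star_smul. Qed.

Lemma cstar_pos_sum (I : Type) (s : seq I) (P : pred I) (F : I -> A) :
  (forall i, P i -> pos (F i)) -> pos (\sum_(i <- s | P i) F i).
Proof.
by move=> FP; elim/big_ind : _ => //; [exact: pos0|exact: cstar_posD].
Qed.

Lemma cstar_pos_lim (u : nat -> A) x :
  cvg_for N u x -> (forall k, pos (u k)) -> pos x.
Proof.
move=> ux upos; apply/unit_emb_pos.
apply: (pos_lim hU el er (u := fun k => unit_emb (u k))).
  by rewrite /cvg_for; under eq_fun do rewrite -unit_embB (unit_norm_emb hN).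
by move=> k; apply/unit_emb_pos.
Qed.

Lemma cstar_pos_sqrt a : pos a ->
  exists s, [/\ pos s, s ** s = a & forall x, x ** a = a ** x -> x ** s = s ** x].
Proof.
move=> /unit_emb_pos /(pos_sqrt hU el er)[s [spos sa sx]].
have s2 : s.2 = 0.
  by have := congr1 snd sa; rewrite /= => /eqP; rewrite mulf_eq0 orbb => /eqP.
rewrite (unit_emb_fst s2) in spos sa sx.
exists s.1; split; first exact/unit_emb_pos.
  by apply: unit_emb_inj; rewrite unit_embM.
move=> x xa; apply: unit_emb_inj; rewrite !unit_embM; apply: sx.
by rewrite -!unit_embM xa.
Qed.

Lemma cstar_pos_sqrt_unique (r s : A) : pos r -> pos s -> r ** r = s ** s -> r = s.
Proof.
move=> /unit_emb_pos rpos /unit_emb_pos spos rs; apply: unit_emb_inj.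
by apply: (pos_sqrt_unique hU el er) => //; rewrite -!unit_embM rs.
Qed.

Lemma cstar_conj_le p x : pos p ->
  pos ((N p)%:C *: (star x ** x) - star x ** p ** x).
Proof.
move=> ppos; have [Np0|Np0] := eqVneq (N p) 0.
  by rewrite (cnorm_eq0 hN Np0) (cnorm0 hN) smul0r smul0l scale0r subr0; exact: pos0.
have Np : 0 < N p by rewrite lt_neqAle eq_sym Np0 (cnorm_ge0 hN).
have : pos ((N p)%:C *: e - unit_emb p).
  apply: (sa_le_norm hU el er) => //; last by rewrite (unit_norm_emb hN).
  by rewrite -unit_emb_star (pos_sa ppos).
move=> /(pos_conj hU el er (unit_emb x)); rewrite smulBr smulBl -unit_emb_star.
rewrite smulZr smulZl er -!unit_embM -unit_embZ -unit_embB.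
by move/unit_emb_pos.
Qed.

(** Taking absolute values does not lose annihilated elements: [k ** x] has the same [star]-square
    as [z ** x]. The last clause is what propagates orthogonality during the lifting. *)
Lemma cstar_abs z : exists k : A, [/\ pos k, k ** k = star z ** z,
  (forall x, x ** (star z ** z) = (star z ** z) ** x -> x ** k = k ** x) &
  forall x, z ** x = 0 -> k ** x = 0].
Proof.
have [k [kpos kk kx]] := cstar_pos_sqrt (cstar_pos_star_smul z).
exists k; split => // x zx; apply: (star_smul_eq0 hN).
by rewrite starM (pos_sa kpos) -smulA (smulA k) kk -!smulA zx !smul0r.
Qed.

(* [y = (1 + a)^-1 x], the inverse being taken in the unitization. *)
Lemma cstar_resolvent a x : pos a -> exists y, x = y + a ** y /\
  forall t : R, 0 <= t -> pos (t%:C *: a - x ** star x) -> N y ^+ 2 <= t / 4.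
Proof.
move=> /unit_emb_pos apos.
have [g [gsa ag _ gag]] := pos_resolvent hU el er apos.
have g_y : g ** unit_emb x = unit_emb (g ** unit_emb x).1.
  by apply: unit_emb_fst; rewrite /= mulr0.
set y := (g ** unit_emb x).1 in g_y; exists y; split.
  apply: unit_emb_inj; rewrite unit_embD unit_embM -g_y.
  rewrite -[X in X + _](el (g ** unit_emb x)) -smulDl smulA.
  by rewrite (_ : (_ + _) ** g = e)// el.
(* Conjugation by [g] turns the hypothesis into a bound of [y ** star y] by [t] times [g ** a ** g],
   whose norm is at most 1/4. *)
move=> t t0 tx; rewrite -(cnorm_cstar' hN) -(unit_norm_emb hN) unit_embM unit_emb_star.
rewrite (le_trans _ (ler_wpM2l t0 gag))// -[X in X * _](ger0_norm t0) -(cnormR hU).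
have gconj (b : unitize A) : pos b -> pos (g ** b ** g).
  by move=> /(pos_conj hU el er g); rewrite gsa.
have -> : unit_emb y ** star (unit_emb y) = g ** unit_emb (x ** star x) ** g.
  by rewrite -g_y starM gsa unit_embM unit_emb_star !smulA.
apply: (pos_mono hU el er); first by apply/gconj/unit_emb_pos/cstar_pos_smul_star.
rewrite -smulZl -smulZr -smulBl -smulBr; apply: gconj.
by rewrite -unit_embZ -unit_embB; apply/unit_emb_pos.
Qed.

End CstarPositive.

(** * Contractivity and range of star homomorphisms *)

Section StarHomNorm.
Variables (R : realType) (A C : starAlgType R) (N : A -> R) (NC : C -> R).
Hypotheses (hN : cstar_norm N) (hNC : cstar_norm NC).
Variable f : A -> C.
Hypothesis hf : star_hom f.

(** The unital extension of [f] preserves positivity of [N x ^+ 2 - star x ** x], and a positive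
    element below a scalar has norm at most that scalar. *)
Lemma star_hom_contractive x : NC (f x) <= N x.
Proof.
have [x0|Nx0] := eqVneq (N x) 0.
  by rewrite (cnorm_eq0 hN x0) (star_hom0 hf) (cnorm0 hN) (cnorm0 hNC).
have Nx : 0 < N x by rewrite lt_neqAle eq_sym Nx0 (cnorm_ge0 hN).
have hU := unit_norm_cstar hN; have hUC := unit_norm_cstar hNC.
have : pos ((N x ^+ 2)%:C *: unit_one A - unit_emb (star x ** x)).
  apply: (sa_le_norm hU (@unit_mul1a R A) (@unit_mula1 R A)).
  - by rewrite -unit_emb_star starM starK.
  - by rewrite exprn_gt0.
  - by rewrite (unit_norm_emb hN) (cnorm_cstar hN).
move=> /(star_hom_pos (star_hom_unitize hf)).
set T := (X in pos X); have -> : T = (N x ^+ 2)%:C *: unit_one C - unit_emb (star (f x) ** f x).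
  apply: unit_eq => //=; rewrite (star_homB hf) (star_homZ hf) (star_hom0 hf).
  by rewrite (star_homM hf) (star_homS hf).
have fx_pos : pos (unit_emb (star (f x) ** f x)).
  by apply/unit_emb_pos; exact: cstar_pos_star_smul hNC _.
move=> /(pos_le_norm hUC (@unit_mul1a R C) (@unit_mula1 R C) (sqr_ge0 (N x)) fx_pos).
rewrite (unit_norm_emb hNC) (cnorm_cstar hNC).
by rewrite ler_pXn2r ?nnegrE ?(cnorm_ge0 hNC) ?(cnorm_ge0 hN).
Qed.

Lemma star_hom_cvg (u : nat -> A) x :
  cvg_for N u x -> cvg_for NC (fun k => f (u k)) (f x).
Proof.
apply: (cvg_for_bounded_by hNC) => k.
by rewrite -(star_homB hf) star_hom_contractive.
Qed.

(** An approximate preimage [d] may have a huge norm. The resolvent of [d ** star d / r ^+ 2] damps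
    it to [y] with [N y <= r / 2], at the price of an error [f (a ** y)] of norm at most
    [121 / 200 * r]; with the initial [r / 10] this stays below [3 / 4 * r]. *)
Let approx_half (c : C) (r : R) :
  (forall t, 0 < t -> exists d, NC (f d - c) < t) -> 0 < r -> NC c <= r ->
  exists d, N d <= r / 2 /\ NC (c - f d) <= 3 / 4 * r.
Proof.
move=> cl r0 cr; have [d dc] := cl (r / 10) (divr_gt0 r0 (ltr0Sn R 9)).
have rV : 0 < r^-1 ^+ 2 by rewrite exprn_gt0// invr_gt0.
pose a := (r^-1 ^+ 2)%:C *: (d ** star d).
have [|y [dE /(_ (r ^+ 2))Ny]] := cstar_resolvent hN d (a := a).
  by apply: posZ; [exact: ltW|exact: cstar_pos_smul_star hN _].
exists y.
have {}Ny : N y <= r / 2.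
  rewrite -(@ler_pXn2r _ 2)// ?nnegrE ?(cnorm_ge0 hN) ?divr_ge0 ?(ltW r0)//.
  rewrite (le_trans (Ny _ _))//; first by rewrite exprn_ge0// ltW.
    rewrite /a scaleRA -exprMn divff ?gt_eqF// expr1n scale1R subrr; exact: pos0.
  by rewrite expr_div_n ler_wpM2l ?exprn_ge0 ?(ltW r0)// -natrX.
split => //.
have fd : NC (f d) <= 11 / 10 * r.
  rewrite -(subrK c (f d)) (le_trans (cnorm_triangle hNC _ _))//.
  by move: (ltW dc); lra.
have -> : c - f y = (c - f d) + f (a ** y).
  by have := congr1 f dE; rewrite (star_homD hf) => ->; rewrite opprD addrA subrK.
have : NC (f (a ** y)) <= r^-1 ^+ 2 * (11 / 10 * r) ^+ 2 * (r / 2).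
  rewrite (star_homM hf) (le_trans (cnorm_submul hNC _ _))//.
  rewrite ler_pM ?(cnorm_ge0 hNC)//; last by rewrite (le_trans (star_hom_contractive _)).
  rewrite (star_homZ hf) (cnormR hNC) ger0_norm ?(ltW rV)// ler_wpM2l ?(ltW rV)//.
  rewrite (star_homM hf) (star_homS hf) (cnorm_cstar' hNC) ler_pXn2r ?nnegrE ?(cnorm_ge0 hNC)//.
  by rewrite mulr_ge0// ?(ltW r0) ?divr_ge0.
have -> : r^-1 ^+ 2 * (11 / 10 * r) ^+ 2 * (r / 2) = 121 / 200 * r.
  by field; rewrite gt_eqF.
move=> ay; rewrite (le_trans (cnorm_triangle hNC _ _))// (cnorm_distC hNC).
by move: (ltW dc); lra.
Qed.

(** As in the open mapping theorem, the residual shrinks by 3/4 at each correction while the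
    corrections stay proportional to it, so their sum converges to an exact preimage. *)
Lemma star_hom_dense_surj :
  (forall c t, 0 < t -> exists d, NC (f d - c) < t) -> forall c, exists d, f d = c.
Proof.
move=> cl c.
(* The hypotheses on the residual and its radius are moved into the conclusion, so that [G] is
   total; where they fail its value is 0. *)
have /choice[G HG] : forall cr : C * R, exists d, 0 < cr.2 -> NC cr.1 <= cr.2 ->
    N d <= cr.2 / 2 /\ NC (cr.1 - f d) <= 3 / 4 * cr.2.
  move=> [c' r] /=; have [/andP[r0 c'r]|H] := boolP ((0 < r) && (NC c' <= r)).
    by have [d Hd] := approx_half (cl c') r0 c'r; exists d.
  by exists 0 => r0 c'r; rewrite r0 c'r in H.
pose r0 := NC c + 1; pose r k := (3 / 4) ^+ k * r0.
have rpos k : 0 < r k.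
  by rewrite mulr_gt0 ?exprn_gt0 ?divr_gt0// ltr_wpDl ?(cnorm_ge0 hNC).
pose w := fix w k : C := if k is k'.+1 then w k' - f (G (w k', r k')) else c.
pose u := fix u k : A := if k is k'.+1 then u k' + G (w k', r k') else 0.
have wr k : NC (w k) <= r k.
  elim: k => [|k IH]; first by rewrite /r expr0 mul1r lerDl.
  have [_ /= le] := HG (w k, r k) (rpos k) IH.
  by rewrite (le_trans le)// /r exprS mulrA.
have fu k : f (u k) = c - w k.
  elim: k => [|k IH] /=; first by rewrite (star_hom0 hf) subrr.
  by rewrite (star_homD hf) IH opprB addrA addrAC.
have [d ud] : exists d, cvg_for N u d.
  (* The correction is at most [r k / 2], which is exactly [2 * r k - 2 * r k.+1]. *)
  apply: (cvg_for_dominated hN (v := fun k => - (2 * r k)) (M := 0)); last first.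
    by move=> k; rewrite oppr_le0 mulr_ge0 ?(ltW (rpos k)).
  move=> k; rewrite /= addrAC subrr add0r; have [le _] := HG (w k, r k) (rpos k) (wr k).
  rewrite (le_trans le)// /r /= exprS; move: (ltW (rpos k)); rewrite /r.
  by lra.
exists d; apply: (cvg_for_unique hNC (star_hom_cvg ud)).
apply: (cvg_for_bounded_by hNC (v := r)).
  by move=> k; rewrite fu addrAC subrr add0r (cnormN hNC).
rewrite -(mul0r r0); apply: cvgMl; apply: cvg_expr.
by rewrite ger0_norm ?divr_ge0// ltr_pdivrMr// mul1r ltr_nat.
Qed.

End StarHomNorm.

(** * Strictly positive elements *)

Section StrictlyPositive.
Variables (R : realType) (A : starAlgType R) (N : A -> R).
Hypotheses (hN : cstar_norm N) (A_sep : separable_for N).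
Implicit Types (a b d g : A) (t : R).

Lemma separable_dense_seq :
  exists d : nat -> A, forall a t, 0 < t -> exists m, N (a - d m) < t.
Proof.
have [D /countable_injP[f finj] Ddense] := A_sep.
have /choice[d Hd] : forall m, exists x, (exists2 y, D y & f y = m) -> D x /\ f x = m.
  move=> m; have [[y Dy fy]|H] := pselect (exists2 y, D y & f y = m); first by exists y.
  by exists 0 => /H.
exists d => a t t0; have [y Dy ya] := Ddense a t t0; exists (f y).
have [Ddy fdy] : D (d (f y)) /\ f (d (f y)) = f y by apply: Hd; exists y.
by rewrite (_ : d (f y) = y)//; apply: finj; rewrite ?inE.
Qed.

Lemma cvg_for_shiftn (u : nat -> A) x n :
  cvg_for N u x -> cvg_for N (fun k => u (k + n)%N) x.
Proof.
move=> /(cvg_forP (cnorm_ge0 hN)) ux; apply/(cvg_forP (cnorm_ge0 hN)) => e /ux[K HK].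
by exists K => k Kk; rewrite HK// (leq_trans Kk)// leq_addr.
Qed.

(** The right ideal [g A] is dense; for positive [g] this is one of the usual forms of strict
    positivity. *)
Definition right_dense g := forall a t, 0 < t -> exists b, N (g ** b - a) < t.

(** [h] is a weighted sum of the [star (d m) ** d m] over a dense sequence. It dominates a multiple
    of each of them, and the resolvent estimate then puts [star (d m)] in the closure of [h A]. *)
Lemma exists_strictly_positive : exists h, pos h /\ right_dense h.
Proof.
have [d Hd] := separable_dense_seq.
(* The weight makes the norm of the term of index [m] at most [2^-1 ^+ m.+1], also when [d m]
   vanishes. *)
pose c m : R := 2^-1 ^+ m.+1 / (1 + N (d m) ^+ 2).
have den m : 0 < 1 + N (d m) ^+ 2 by rewrite ltr_pwDl// sqr_ge0.
have c0 m : 0 < c m by rewrite divr_gt0// exprn_gt0// invr_gt0.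
pose dd m := star (d m) ** d m.
have dd_pos m : pos ((c m)%:C *: dd m).
  by apply: posZ; [exact: ltW|exact: cstar_pos_star_smul hN _].
pose H := fix H k : A := if k is k'.+1 then H k' + (c k')%:C *: dd k' else 0.
have H_pos k : pos (H k).
  by elim: k => [|k IH] /=; [exact: pos0|exact: (cstar_posD hN)].
have [h Hh] : exists h, cvg_for N H h.
  apply: (cvg_for_dominated hN (v := fun k => - 2^-1 ^+ k) (M := 0)); last first.
    by move=> k; rewrite oppr_le0 exprn_ge0// invr_ge0.
  move=> k; rewrite /= addrAC subrr add0r (cnormR hN) (cnorm_cstar hN) gtr0_norm//.
  have -> : - 2^-1 ^+ k.+1 - - 2^-1 ^+ k = 2^-1 ^+ k.+1 :> R.
    by rewrite exprS; lra.
  rewrite /c mulrAC -mulrA ler_piMr ?exprn_ge0 ?invr_ge0//.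
  by rewrite ler_pdivrMr// mul1r lerDr.
(* The partial sums contain the term of index [m] only from [m.+1] on, hence the shift. *)
have h_ge m : pos (h - (c m)%:C *: dd m).
  apply: (cstar_pos_lim hN (u := fun k => H (k + m.+1)%N - (c m)%:C *: dd m)).
    by apply: (cvg_forB hN); [exact: cvg_for_shiftn|exact: cvg_for_cst].
  elim=> [|k IH]; first by rewrite add0n /= addrK.
  by rewrite addSn /= addrAC; exact: (cstar_posD hN).
have h_pos : pos h by exact: (cstar_pos_lim hN Hh).
exists h; split=> // a t t0.
have t2 : 0 < t / 2 by rewrite divr_gt0.
(* The adjoint is approximated because [h] dominates a multiple of [star (d m) ** d m], which is
   [x ** star x] for [x = star (d m)]. *)
have [m am] := Hd (star a) _ t2.
(* [star (d m) = y + h y / s] with [|y|^2 <= s / (4 c m)] *)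
pose s := c m * t ^+ 2 / 2.
have s0 : 0 < s by rewrite divr_gt0// mulr_gt0// exprn_gt0.
have [|y [dE Hy]] := cstar_resolvent hN (star (d m)) (a := s^-1%:C *: h).
  by apply: posZ => //; rewrite invr_ge0 ltW.
have Ny : N y < t / 2.
  rewrite -(@ltr_pXn2r _ 2)// ?nnegrE ?(cnorm_ge0 hN) ?(ltW t2)//.
  apply: (@le_lt_trans _ _ ((s / c m) / 4)).
    apply: Hy; first by rewrite divr_ge0 ?ltW.
    rewrite scaleRA mulrAC divff ?gt_eqF// mul1r starK.
    have -> : (c m)^-1%:C *: h - star (d m) ** d m =
        (c m)^-1%:C *: (h - (c m)%:C *: dd m).
      by rewrite scalerBr scaleRA mulVf ?gt_eqF// scale1R.
    by apply: posZ => //; rewrite invr_ge0 ltW.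
  have -> : s / c m / 4 = t ^+ 2 / 8 by rewrite /s; field; rewrite gt_eqF.
  have tt : 0 < t ^+ 2 by rewrite exprn_gt0.
  by rewrite ?expr_div_n; lra.
exists (s^-1%:C *: y); rewrite smulZr -smulZl.
have -> : (s^-1%:C *: h) ** y - a = - y + (star (d m) - a).
  by rewrite dE addrA [- y + _]addrA addNr add0r.
rewrite (le_lt_trans (cnorm_triangle hN _ _))// (cnormN hN) [ltRHS]splitr ltrD//.
by rewrite -(cnorm_star hN) starB starK (cnorm_distC hN).
Qed.

Lemma right_denseM g1 g2 : right_dense g1 -> right_dense g2 -> right_dense (g1 ** g2).
Proof.
move=> dg1 dg2 a t t0; have t2 : 0 < t / 2 by rewrite divr_gt0.
have [b1 Hb1] := dg1 a _ t2.
have g1p := norm1_gt0 hN g1.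
have [b2 Hb2] := dg2 b1 _ (divr_gt0 t2 g1p).
exists b2; have -> : g1 ** g2 ** b2 - a = g1 ** (g2 ** b2 - b1) + (g1 ** b1 - a).
  by rewrite smulBr smulA addrA subrK.
rewrite (le_lt_trans (cnorm_triangle hN _ _))// [ltRHS]splitr ler_ltD//.
rewrite (le_trans (cnorm_submul hN _ _))//.
rewrite (le_trans (ler_wpM2l (cnorm_ge0 hN _) (ltW Hb2)))//.
rewrite mulrCA ler_piMr ?(ltW t2)// ler_pdivrMr// mul1r.
by rewrite lerDl.
Qed.

Lemma two_sided_dense g : star g = g -> right_dense g ->
  forall a t, 0 < t -> exists b, N (g ** b ** g - a) < t.
Proof.
move=> gsa dg a t t0; have t2 : 0 < t / 2 by rewrite divr_gt0.
have [b1 Hb1] := dg a _ t2; have gp := norm1_gt0 hN g.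
have [b2 Hb2] := dg (star b1) _ (divr_gt0 t2 gp).
exists (star b2).
have -> : g ** star b2 ** g - a = g ** star (g ** b2 - star b1) + (g ** b1 - a).
  by rewrite starB starK starM gsa smulBr smulA addrA subrK.
rewrite (le_lt_trans (cnorm_triangle hN _ _))// [ltRHS]splitr ler_ltD//.
rewrite (le_trans (cnorm_submul hN _ _))// (cnorm_star hN).
rewrite (le_trans (ler_wpM2l (cnorm_ge0 hN _) (ltW Hb2)))//.
rewrite mulrCA ler_piMr ?(ltW t2)// ler_pdivrMr// mul1r.
by rewrite lerDl.
Qed.

End StrictlyPositive.

(** * Lifting along surjections *)

Section OrthogonalLifting.
Variables (R : realType) (B C : starAlgType R) (NB : B -> R) (NC : C -> R).
Hypotheses (hNB : cstar_norm NB) (hNC : cstar_norm NC).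
Variable rho : B -> C.
Hypothesis hrho : star_hom rho.

(** [p] and [r] are the positive and negative parts of [y]. As [u ** v = 0], the squares of [u - v]
    and [u + v] agree, so uniqueness of positive roots makes [rho] send the absolute value of [y] to
    [u + v]. *)
Lemma orthogonal_lift (y : B) (u v : C) :
  star y = y -> rho y = u - v -> pos u -> pos v -> u ** v = 0 ->
  exists p r : B, [/\ star p = p /\ star r = r, p ** r = 0, rho p = u, rho r = v &
    forall x, y ** x = 0 -> p ** x = 0 /\ r ** x = 0].
Proof.
move=> ysa rhoy upos vpos uv.
have vu : v ** u = 0 by rewrite -(pos_sa upos) -(pos_sa vpos) -starM uv star0.
have [k [kpos kk kx k0]] := cstar_abs hNB y; rewrite ysa in kk kx.
have ky : y ** k = k ** y by apply: kx; rewrite smulA.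
have rhok : rho k = u + v.
  apply: (cstar_pos_sqrt_unique hNC); [exact: star_hom_pos|exact: (cstar_posD hNC)|].
  rewrite -(star_homM hrho) kk (star_homM hrho) rhoy.
  by rewrite smulBl !smulBr smulDl !smulDr uv vu subr0 sub0r opprK addr0 add0r.
exists (2^-1%:C *: (k + y)), (2^-1%:C *: (k - y)); split.
- split; first by rewrite starZ_real starD (pos_sa kpos) ysa.
  by rewrite starZ_real starB (pos_sa kpos) ysa.
- rewrite smulZl smulZr smulDl !smulBr kk ky addrA subrK subrr.
  by rewrite !scaler0.
- rewrite (star_homZ hrho) (star_homD hrho) rhok rhoy.
  by rewrite addrACA subrr addr0 halfZ_double.
- rewrite (star_homZ hrho) (star_homB hrho) rhok rhoy.
  by rewrite opprB [v - u]addrC addrACA subrr add0r halfZ_double.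
- move=> x yx; rewrite !smulZl smulDl smulBl yx (k0 _ yx).
  by rewrite subr0 addr0 scaler0.
Qed.

(** [rho] sends the absolute value of [z] to a positive root of [star (rho z) ** rho z], and such
    roots are unique. *)
Lemma abs_lift (z : B) (w : C) :
  pos w -> star (rho z) ** rho z = w ** w ->
  exists k : B, [/\ star k = k, k ** k = star z ** z, rho k = w &
    forall x, z ** x = 0 -> k ** x = 0].
Proof.
move=> wpos zw; have [k [kpos kk _ k0]] := cstar_abs hNB z.
exists k; split => //; first exact: pos_sa.
apply: (cstar_pos_sqrt_unique hNC) => //; first exact: star_hom_pos.
by rewrite -(star_homM hrho) kk (star_homM hrho) (star_homS hrho).
Qed.

End OrthogonalLifting.

(** * The C*-norm of matrices *)

Lemma cvg_sum0 (R : realType) (I : finType) (F : I -> nat -> R) :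
  (forall i, F i k @[k --> \oo] --> (0 : R)) ->
  (\sum_i F i k) @[k --> \oo] --> (0 : R).
Proof.
move=> F0; elim: (index_enum I) => [|i s IH].
  by rewrite (_ : (fun _ => _) = fun=> 0) ?funeqE => [|k]; [exact: cvg_cst|rewrite big_nil].
rewrite (_ : (fun _ => _) = fun k => F i k + \sum_(j <- s) F j k); last first.
  by apply/funext => k; rewrite big_cons.
by rewrite -[X in _ --> X]addr0; exact: cvgD.
Qed.

Lemma sum_sqr_le (R : realType) (I : finType) (a : I -> R) :
  (forall i, 0 <= a i) -> \sum_i a i ^+ 2 <= (\sum_i a i) ^+ 2.
Proof.
move=> a0; rewrite [leRHS]expr2 mulr_suml; apply: ler_sum => i _.
by rewrite expr2 ler_wpM2l// (bigD1 i)//= lerDl sumr_ge0.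
Qed.

Section MatrixNorm.
Variables (R : realType) (n : nat) (A : starAlgType R) (N : A -> R).
Hypothesis hN : cstar_norm N.
Local Notation M := (star_mx n A).
Local Notation col := 'cV[A]_n.
Implicit Types (x y : col) (S T : M).

Definition ip x y : A := \sum_i star (x i 0) ** y i 0.

Lemma ip_pos x : pos (ip x x).
Proof. by apply: (cstar_pos_sum hN) => i _; exact: (cstar_pos_star_smul hN). Qed.

Lemma star_ip x y : star (ip x y) = ip y x.
Proof. by rewrite star_sum; apply: eq_bigr => i _; rewrite starM starK. Qed.

Lemma ipDl x y z : ip (x + y) z = ip x z + ip y z.
Proof. by rewrite -big_split; apply: eq_bigr => i _; rewrite mxE starD smulDl. Qed.

Lemma ipDr x y z : ip z (x + y) = ip z x + ip z y.
Proof. by rewrite -big_split; apply: eq_bigr => i _; rewrite mxE smulDr. Qed.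

Local Notation cn := (col_norm N).

Lemma col_norm_ge0 x : 0 <= cn x. Proof. exact: sqrtr_ge0. Qed.

Lemma sqr_col_norm x : cn x ^+ 2 = N (ip x x).
Proof. by rewrite sqr_sqrtr ?(cnorm_ge0 hN). Qed.

(** Positivity of [ip z z] for [z = x a - s y], with [star a ** ip x x ** a] at most [s] times
    [star a ** a], gives that [s] times [star a ** a] is at most [s ^+ 2] times [ip y y]. One factor
    [s] is then cancelled. *)
Lemma ip_cauchy_schwarz x y : N (ip x y) <= cn x * cn y.
Proof.
rewrite -(@ler_pXn2r _ 2)// ?nnegrE ?mulr_ge0 ?col_norm_ge0 ?(cnorm_ge0 hN)//.
rewrite exprMn !sqr_col_norm; set a := ip x y; set s := N (ip x x).
have s_ge0 : 0 <= s := cnorm_ge0 hN _.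
pose t := s%:C; pose z : col := \col_i (x i 0 ** a - t *: y i 0).
have zE : ip z z = star a ** ip x x ** a - t *: (star a ** a) - t *: (star a ** a)
    + t *: (t *: ip y y).
  have aa1 : star a ** a = \sum_i star (y i 0) ** x i 0 ** a.
    by rewrite star_ip /ip smul_suml.
  have aa2 : star a ** a = \sum_i star a ** (star (x i 0) ** y i 0).
    by rewrite -smul_sumr.
  rewrite [in X in _ - X + _]aa1 [in X in _ - X - _ + _]aa2.
  rewrite [in X in X - _ - _ + _]/ip smul_sumr smul_suml [ip y y]/ip.
  rewrite !scaler_sumr -!sumrB -big_split.
  apply: eq_bigr => i _; rewrite !mxE /t starB starZ_real starM.
  by rewrite smulBl !smulBr !smulZl !smulZr !smulA opprB addrA addrAC.
have : N (t *: (star a ** a)) <= N (t *: (t *: ip y y)).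
  apply: (cstar_pos_mono hN).
    by apply: posZ => //; exact: (cstar_pos_star_smul hN).
  have -> : t *: (t *: ip y y) - t *: (star a ** a) =
      (t *: (star a ** a) - star a ** ip x x ** a) + ip z z.
    by rewrite zE !addrA subrK subrr sub0r addrC.
  apply: (cstar_posD hN); last exact: ip_pos.
  exact: (cstar_conj_le hN _ (ip_pos x)).
rewrite !(cnormR hN) ger0_norm// (cnorm_cstar hN).
have [s0|s_neq0] := eqVneq s 0; last first.
  by rewrite ler_pM2l// lt_neqAle eq_sym s_neq0.
(* For [s = 0] nothing can be cancelled, but each [star (x i 0) ** x i 0] lies below [ip x x], so
   the column vanishes. *)
have x0 i : x i 0 = 0.
  apply: (star_smul_eq0 hN); apply: (cnorm_le0 hN); rewrite -s0.
  apply: (cstar_pos_mono hN); first exact: (cstar_pos_star_smul hN).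
  rewrite /ip (bigD1 i)//= addrAC subrr add0r.
  by apply: (cstar_pos_sum hN) => j _; exact: (cstar_pos_star_smul hN).
move=> _; rewrite (_ : a = 0) ?(cnorm0 hN) ?expr0n ?mulr_ge0 ?(cnorm_ge0 hN)//.
by rewrite /a /ip big1// => i _; rewrite x0 star0 smul0l.
Qed.

Lemma col_normD x y : cn (x + y) <= cn x + cn y.
Proof.
rewrite -(@ler_pXn2r _ 2)// ?nnegrE ?addr_ge0 ?col_norm_ge0//.
rewrite sqr_col_norm ipDl !ipDr sqrrD !sqr_col_norm -addrA -[leRHS]addrA.
rewrite (le_trans (cnorm_triangle hN _ _))// lerD2l.
rewrite addrA (le_trans (cnorm_triangle hN _ _))// lerD2r.
rewrite (le_trans (cnorm_triangle hN _ _))// mulr2n lerD ?ip_cauchy_schwarz//.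
by rewrite mulrC ip_cauchy_schwarz.
Qed.

Lemma entry_le_col_norm x i : N (x i 0) <= cn x.
Proof.
rewrite -(@ler_pXn2r _ 2)// ?nnegrE ?col_norm_ge0 ?(cnorm_ge0 hN)//.
rewrite sqr_col_norm -(cnorm_cstar hN); apply: (cstar_pos_mono hN).
  exact: (cstar_pos_star_smul hN).
rewrite /ip (bigD1 i)//= addrAC subrr add0r.
by apply: (cstar_pos_sum hN) => j _; exact: (cstar_pos_star_smul hN).
Qed.

Lemma col_norm_le x : cn x <= \sum_i N (x i 0).
Proof.
have s0 : 0 <= \sum_i N (x i 0) by rewrite sumr_ge0// => i _; exact: (cnorm_ge0 hN).
rewrite -(@ler_pXn2r _ 2)// ?nnegrE ?col_norm_ge0// sqr_col_norm.
rewrite (le_trans (cnorm_sum hN _ _ _))//.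
under eq_bigr do rewrite (cnorm_cstar hN).
by apply: sum_sqr_le => i; exact: (cnorm_ge0 hN).
Qed.

Definition col_scale (c : R[i]) x : col := \col_i (c *: x i 0).

Lemma col_normZ c x : cn (col_scale c x) = absC c * cn x.
Proof.
apply/eqP; rewrite -(@eqrXn2 _ 2)// ?mulr_ge0 ?absC_ge0 ?col_norm_ge0//; apply/eqP.
rewrite exprMn !sqr_col_norm.
have -> : ip (col_scale c x) (col_scale c x) = (absC c ^+ 2)%:C *: ip x x.
  rewrite /ip scaler_sumr; apply: eq_bigr => i _.
  by rewrite !mxE starZ smulZl smulZr scalerA rmorphXn /= absCE normCKC.
by rewrite (cnormR hN) ger0_norm// exprn_ge0// absC_ge0.
Qed.

Lemma smx_colD S T x : smx_col (S + T) x = smx_col S x + smx_col T x.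
Proof.
apply/matrixP => i j; rewrite !mxE -big_split.
by apply: eq_bigr => k _; rewrite mxE smulDl.
Qed.

Lemma smx_colZ c T x : smx_col (c *: T) x = col_scale c (smx_col T x).
Proof.
apply/matrixP => i j; rewrite !mxE scaler_sumr.
by apply: eq_bigr => k _; rewrite mxE smulZl.
Qed.

Lemma smx_colZr c T x : smx_col T (col_scale c x) = col_scale c (smx_col T x).
Proof.
apply/matrixP => i j; rewrite !mxE scaler_sumr.
by apply: eq_bigr => k _; rewrite mxE smulZr.
Qed.

Lemma smx_colM S T x : smx_col (S ** T) x = smx_col S (smx_col T x).
Proof.
apply/matrixP => i j; rewrite !mxE.
under eq_bigr do rewrite mxE smul_suml.
rewrite exchange_big /=; apply: eq_bigr => k _.
by rewrite mxE smul_sumr; apply: eq_bigr => l _; rewrite smulA.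
Qed.

Lemma ip_smx_col T x y : ip (smx_col T x) y = ip x (smx_col (star T) y).
Proof.
rewrite /ip; under eq_bigr do rewrite mxE star_sum smul_suml.
rewrite exchange_big /=; apply: eq_bigr => j _.
rewrite mxE smul_sumr; apply: eq_bigr => i _.
by rewrite mxE starM smulA.
Qed.

Lemma smx_col_adj T x :
  cn (smx_col T x) ^+ 2 <= cn x * cn (smx_col (star T ** T) x).
Proof. by rewrite sqr_col_norm ip_smx_col -smx_colM ip_cauchy_schwarz. Qed.

Lemma smx_col_le T x : cn (smx_col T x) <= (\sum_i \sum_j N (T i j)) * cn x.
Proof.
rewrite (le_trans (col_norm_le _))// mulr_suml; apply: ler_sum => i _.
rewrite mxE (le_trans (cnorm_sum hN _ _ _))// mulr_suml; apply: ler_sum => j _.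
rewrite (le_trans (cnorm_submul hN _ _))// ler_wpM2l ?(cnorm_ge0 hN)//.
exact: entry_le_col_norm.
Qed.

Let sum_ge0 T : 0 <= \sum_i \sum_j N (T i j).
Proof. by do 2!(apply: sumr_ge0 => ? _); exact: (cnorm_ge0 hN). Qed.

Let bounded T : exists2 m, 0 <= m & forall x, cn (smx_col T x) <= m * cn x.
Proof. by exists (\sum_i \sum_j N (T i j)) => //; exact: smx_col_le. Qed.

Let dil (r : R) x := col_scale r%:C x.

Let cn_dil r x : 0 <= r -> cn (dil r x) = r * cn x.
Proof. by move=> r0; rewrite col_normZ absC_real ger0_norm. Qed.

Let act_dil r T x : 0 <= r -> cn (smx_col T (dil r x)) = r * cn (smx_col T x).
Proof. by move=> r0; rewrite smx_colZr col_normZ absC_real ger0_norm. Qed.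

Let cn0 : cn (0 : col) <= 1.
Proof.
rewrite (le_trans (col_norm_le _))// big1 ?ler01// => i _.
by rewrite mxE (cnorm0 hN).
Qed.

Let cnD S T x : cn (smx_col (S + T) x) <= cn (smx_col S x) + cn (smx_col T x).
Proof. by rewrite smx_colD col_normD. Qed.

Let cnZ c T x : cn (smx_col (c *: T) x) = absC c * cn (smx_col T x).
Proof. by rewrite smx_colZ col_normZ. Qed.

Local Notation mxn := (star_mx_norm (n := n) N).

Lemma star_mx_norm_ge0 T : 0 <= mxn T.
Proof. exact: (operator_norm_ge0 col_norm_ge0 cn0 bounded). Qed.

Lemma star_mx_norm_le T : mxn T <= \sum_i \sum_j N (T i j).
Proof. by apply: (operator_norm_le cn0) => //; exact: smx_col_le. Qed.

(** In the absence of a unit vector the test column carries [star (T i j)] in place [j]. *)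
Lemma entry_le_star_mx_norm T i j : N (T i j) <= mxn T.
Proof.
have [->|Tij] := eqVneq (N (T i j)) 0; first exact: star_mx_norm_ge0.
have T0 : 0 < N (T i j) by rewrite lt_neqAle eq_sym Tij (cnorm_ge0 hN).
rewrite -(ler_pM2r T0) -expr2 -(cnorm_cstar' hN).
pose x : col := \col_k (if k == j then star (T i j) else 0).
have cx : cn x <= N (T i j).
  rewrite (le_trans (col_norm_le _))// (bigD1 j)//= mxE eqxx (cnorm_star hN).
  by rewrite big1 ?addr0// => k /negPf kj; rewrite mxE kj (cnorm0 hN).
have -> : T i j ** star (T i j) = smx_col T x i 0.
  rewrite mxE (bigD1 j)//= mxE eqxx big1 ?addr0// => k /negPf kj.
  by rewrite mxE kj smul0r.
rewrite (le_trans (entry_le_col_norm _ _))//.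
rewrite (le_trans (operator_norm_ub col_norm_ge0 cn_dil act_dil bounded _ _))//.
by rewrite ler_wpM2l// star_mx_norm_ge0.
Qed.

Lemma star_mx_norm_cstar : cstar_norm (A := star_mx n A) mxn.
Proof.
split.
- exact: (operator_normD col_norm_ge0 cn0 cn_dil act_dil bounded cnD).
- exact: (operator_normZ col_norm_ge0 cn0 cn_dil act_dil bounded cnZ).
- move=> T T0; apply/matrixP => i j; rewrite mxE; apply: (cnorm_le0 hN).
  by rewrite -T0 entry_le_star_mx_norm.
- exact: (operator_normM col_norm_ge0 cn0 cn_dil act_dil bounded smx_colM).
- exact: (operator_norm_cstar col_norm_ge0 cn0 cn_dil act_dil bounded smx_colM smx_col_adj).
move=> u uc.
have /choice[l Hl] : forall ij : 'I_n * 'I_n,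
    exists a, cvg_for N (fun k => (u k : 'M[A]_n) ij.1 ij.2) a.
  move=> [i j]; apply: (cnorm_complete hN) => e /uc[K HK]; exists K => p q Kp Kq /=.
  rewrite (le_lt_trans _ (HK p q Kp Kq))//.
  by have := entry_le_star_mx_norm (u p - u q) i j; rewrite !mxE.
exists (\matrix_(i, j) l (i, j)).
apply: (@squeeze_cvgr _ _ _ _ (fun=> 0)
  (fun k => \sum_i \sum_j N ((u k : 'M[A]_n) i j - l (i, j)))).
- near=> k; rewrite star_mx_norm_ge0 (le_trans (star_mx_norm_le _))//.
  by apply: ler_sum => i _; apply: ler_sum => j _; rewrite !mxE.
- exact: cvg_cst.
- by do 2!apply: cvg_sum0 => ?; exact: (Hl (_, _)).
Unshelve. all: by end_near.
Qed.

Lemma star_mx_norm_separable :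
  separable_for N -> separable_for (A := star_mx n A) mxn.
Proof.
move=> /separable_dense_seq[d Hd].
pose F (k : 'M[nat]_n) : M := \matrix_(i, j) d (k i j).
exists (range F).
  apply/countable_injP.
  have /choice[g Hg] : forall T : M, exists k, range F T -> F k = T.
    move=> T; have [[k _ kT]|H] := pselect (range F T); first by exists k.
    by exists 0 => /H.
  exists (pickle \o g) => T1 T2; rewrite !inE => /Hg T1E /Hg T2E /= /(pcan_inj pickleK) gE.
  by rewrite -T1E -T2E gE.
(* The successor keeps the denominator nonzero for [n = 0] and makes the sum of the [n ^ 2] errors
   strictly less than [e]. *)
move=> T e e0; pose r := e / (n ^ 2).+1%:R.
have r0 : 0 < r by rewrite divr_gt0.
have /choice[k Hk] : forall ij : 'I_n * 'I_n,
    exists m, N ((T : 'M[A]_n) ij.1 ij.2 - d m) < r by move=> ij; exact: Hd.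
exists (F (\matrix_(i, j) k (i, j))); first by exists (\matrix_(i, j) k (i, j)).
apply: (@le_lt_trans _ _ (\sum_(i < n) \sum_(j < n) r)).
  rewrite (le_trans (star_mx_norm_le _))//.
  apply: ler_sum => i _; apply: ler_sum => j _; rewrite !mxE.
  exact: ltW (Hk (i, j)).
rewrite !sumr_const !card_ord -mulrnA mulnn -mulr_natr /r mulrAC ltr_pdivrMr//.
by rewrite ltr_pM2l// ltr_nat.
Qed.

End MatrixNorm.

(** * Lifting a column of matrix units *)

(** The powers of [h] with positive exponent, given without exponents: only their stability under
    products, their positivity and their density are ever needed. *)
Inductive prod_powers (R : realType) (A : starAlgType R) (h : A) : A -> Prop :=
| prod_powers1 : prod_powers h h
| prod_powersS g : prod_powers h g -> prod_powers h (h ** g).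

Section ProdPowers.
Variables (R : realType) (A : starAlgType R) (N : A -> R).
Hypothesis hN : cstar_norm N.
Variable h : A.
Hypotheses (h_pos : pos h) (h_dense : right_dense N h).
Local Notation pw := (prod_powers h).

Lemma prod_powers_comm1 g : pw g -> g ** h = h ** g.
Proof. by elim=> // g' _ IH; rewrite -smulA IH. Qed.

Lemma prod_powersM g1 g2 : pw g1 -> pw g2 -> pw (g1 ** g2).
Proof.
move=> H1 H2; elim: H1 => [|g _ IH]; first exact: prod_powersS.
by rewrite -smulA; exact: prod_powersS.
Qed.

Lemma prod_powers_pos g : pw g -> pos g.
Proof.
elim=> // g' Hg IH; apply: (cstar_posM hN) => //.
by rewrite prod_powers_comm1.
Qed.

Lemma prod_powers_dense g : pw g -> right_dense N g.
Proof. by elim=> // g' _ IH; exact: right_denseM. Qed.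

End ProdPowers.

Section MatrixUnits.
Variables (R : realType) (n : nat) (A : starAlgType R).
Local Notation M := (star_mx n A).
Implicit Types (i j k l : 'I_n) (a b : A).

Definition mx_unit i j a : M :=
  \matrix_(k, l) (if (k == i) && (l == j) then a else 0).

Lemma mx_unit_linear i j : linear (mx_unit i j).
Proof.
move=> c a b; apply/matrixP => k l; rewrite !mxE.
by case: ifP => // _; rewrite scaler0 addr0.
Qed.

Lemma mx_unitM i j k l a b :
  mx_unit i j a ** mx_unit k l b = if j == k then mx_unit i l (a ** b) else 0.
Proof.
apply/matrixP => p q; rewrite !mxE; case: eqVneq => [<-|jk].
  rewrite mxE (bigD1 j)//= !mxE eqxx andbT big1 ?addr0 => [|m /negPf mj].
    by case: (p == i); rewrite ?smul0l//=; case: (q == l); rewrite ?smul0r.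
  by rewrite !mxE mj andbF smul0l.
rewrite mxE big1// => m _; rewrite !mxE; case: (eqVneq m j) => [->|_].
  by rewrite (negPf jk) smul0r.
by rewrite andbF smul0l.
Qed.

Lemma star_mx_unit i j a : star (mx_unit i j a) = mx_unit j i (star a).
Proof.
apply/matrixP => k l; rewrite !mxE andbC.
by case: ifP => // _; rewrite star0.
Qed.

Lemma mx_unit_sum (T : M) : T = \sum_i \sum_j mx_unit i j (T i j).
Proof.
apply/matrixP => k l; rewrite summxE (bigD1 k)//= summxE (bigD1 l)//= !mxE !eqxx.
rewrite !big1 ?addr0// => [i /negPf ik|j /negPf jl].
  by rewrite summxE big1// => j _; rewrite mxE eq_sym ik.
by rewrite mxE eqxx eq_sym jl.
Qed.

End MatrixUnits.

Section MatrixUnitLifting.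
Variables (R : realType) (n : nat) (A : starAlgType R) (N : A -> R).
Hypothesis hN : cstar_norm N.
Variables (B C : starAlgType R) (NB : B -> R) (NC : C -> R).
Hypotheses (hNB : cstar_norm NB) (hNC : cstar_norm NC).
Variables (phi : star_mx n.+1 A -> C) (rho : B -> C).
Hypotheses (hphi : star_hom phi) (hrho : star_hom rho).
Hypothesis rho_surj : forall c, exists b, rho b = c.
Implicit Types (i j k l : 'I_n.+1) (a b : A).

Definition cunit i j a : C := phi (mx_unit i j a).

Lemma cunitD i j a b : cunit i j (a + b) = cunit i j a + cunit i j b.
Proof.
rewrite /cunit -(star_homD hphi); congr phi.
by have := mx_unit_linear i j 1 a b; rewrite !scale1r.
Qed.

Lemma cunit0 i j : cunit i j 0 = 0.
Proof. by apply: (addrI (cunit i j 0)); rewrite -cunitD !addr0. Qed.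

Lemma cunitZ i j (c : R[i]) a : cunit i j (c *: a) = c *: cunit i j a.
Proof.
rewrite /cunit -(star_homZ hphi); congr phi.
have := mx_unit_linear i j c a 0; rewrite addr0 => ->.
by apply/matrixP => k l; rewrite !mxE; case: ifP => _; rewrite ?addr0// scaler0 addr0.
Qed.

Lemma cunitB i j a b : cunit i j (a - b) = cunit i j a - cunit i j b.
Proof. by rewrite cunitD -scaleN1r cunitZ scaleN1r. Qed.

Lemma cunitM i j k l a b :
  cunit i j a ** cunit k l b = if j == k then cunit i l (a ** b) else 0.
Proof.
rewrite /cunit -(star_homM hphi) mx_unitM.
by case: eqP => // _; exact: star_hom0.
Qed.

Lemma cunitMM i j l a b : cunit i j a ** cunit j l b = cunit i l (a ** b).
Proof. by rewrite cunitM eqxx. Qed.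

Lemma star_cunit i j a : star (cunit i j a) = cunit j i (star a).
Proof. by rewrite /cunit -(star_homS hphi) star_mx_unit. Qed.

Lemma cunit_norm i j a : NC (cunit i j a) <= N a.
Proof.
rewrite (le_trans (star_hom_contractive (star_mx_norm_cstar n.+1 hN) hNC hphi _))//.
rewrite (le_trans (star_mx_norm_le hN _))// (bigD1 i)//= (bigD1 j)//= mxE !eqxx.
rewrite !big1 ?addr0// => [k /negPf ki|l /negPf lj].
  by rewrite big1// => l _; rewrite mxE ki (cnorm0 hN).
by rewrite mxE lj andbF (cnorm0 hN).
Qed.

Lemma cunit_hom i : star_hom (cunit i i).
Proof.
split=> [c a b|a b|a]; first by rewrite cunitD cunitZ.
  by rewrite cunitMM.
by rewrite star_cunit.
Qed.

Definition cdiag (P : pred 'I_n.+1) a : C := \sum_(i | P i) cunit i i a.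

Lemma cdiagM P a b : cdiag P a ** cdiag P b = cdiag P (a ** b).
Proof.
rewrite /cdiag (big_morph (smul^~ _) (fun x y => smulDl x y _) (smul0l _)).
apply: eq_bigr => i Pi.
rewrite (big_morph (smul _) (fun x y => smulDr _ x y) (smul0r _)) (bigD1 i)//= cunitMM.
by rewrite big1 ?addr0// => j /andP[_ /negPf ji]; rewrite cunitM eq_sym ji.
Qed.

Lemma cdiag_hom P : star_hom (cdiag P).
Proof.
split=> [c a b|a b|a]; last 2 first.
- by rewrite cdiagM.
- rewrite [RHS](big_morph _ (@starD R C) (star0 C)); apply: eq_bigr => i _.
  by rewrite star_cunit.
rewrite /cdiag scaler_sumr -big_split; apply: eq_bigr => i _.
by rewrite cunitD cunitZ.
Qed.

Lemma cunit_cdiag (P : pred 'I_n.+1) i j a b :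
  cunit i j a ** cdiag P b = if P j then cunit i j (a ** b) else 0.
Proof.
rewrite /cdiag (big_morph (smul _) (fun x y => smulDr _ x y) (smul0r _)).
case: ifP => Pj.
  rewrite (bigD1 j)//= cunitMM big1 ?addr0// => k /andP[_ /negPf kj].
  by rewrite cunitM eq_sym kj.
by rewrite big1// => k Pk; rewrite cunitM; case: eqP => // jk; rewrite -jk Pj in Pk.
Qed.

Lemma cdiag_cunit (P : pred 'I_n.+1) i j a b :
  cdiag P b ** cunit i j a = if P i then cunit i j (b ** a) else 0.
Proof.
rewrite /cdiag (big_morph (smul^~ _) (fun x y => smulDl x y _) (smul0l _)).
case: ifP => Pi.
  rewrite (bigD1 i)//= cunitMM big1 ?addr0// => k /andP[_ /negPf ki].
  by rewrite cunitM ki.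
by rewrite big1// => k Pk; rewrite cunitM; case: eqP => // ki; rewrite ki Pi in Pk.
Qed.

Lemma sa_lift (c : C) : star c = c -> exists2 b, star b = b & rho b = c.
Proof.
move=> csa; have [b bc] := rho_surj c.
exists (2^-1%:C *: (b + star b)); first by rewrite starZ_real starD starK addrC.
by rewrite (star_homZ hrho) (star_homD hrho) (star_homS hrho) bc csa halfZ_double.
Qed.

Variable h : A.
Hypotheses (h_pos : pos h).
Local Notation pw := (prod_powers h).

(* The [x i], [i <= k], lift the column [g (x) e_(i, k)]; [r] lifts
   [g' (x) (1 - e_00 - ... - e_kk)] and leaves room for the next step. *)
Record partial_column (k : nat) (x : 'I_n.+1 -> B) (r : B) (g g' : A) : Prop := {
  pcol_g : pw g;
  pcol_g' : pw g';
  pcol_orth : forall i j, (i <= k)%N -> (j <= k)%N -> i != j -> star (x i) ** x j = 0;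
  pcol_norm : forall i j, (i <= k)%N -> (j <= k)%N ->
    star (x i) ** x i = star (x j) ** x j;
  pcol_rsa : star r = r;
  pcol_r : forall i, (i <= k)%N -> r ** x i = 0;
  pcol_rho : forall i, (i <= k)%N -> rho (x i) = cunit i (inord k) g;
  pcol_rhor : rho r = cdiag (fun j => (k < j)%N) g'
}.

Lemma split_diag (y : B) k g : pw g -> star y = y ->
  rho y = cunit k k g - cdiag (fun j => (k < j)%N) g ->
  exists p r : B, [/\ star p = p /\ star r = r, p ** r = 0,
    rho p = cunit k k g, rho r = cdiag (fun j => (k < j)%N) g &
    forall x, y ** x = 0 -> p ** x = 0 /\ r ** x = 0].
Proof.
move=> gpw ysa rhoy; have gpos := prod_powers_pos hN h_pos gpw.
apply: (orthogonal_lift hNB hNC hrho ysa rhoy).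
- exact: (star_hom_pos (cunit_hom k)).
- exact: (star_hom_pos (cdiag_hom _)).
- by rewrite cunit_cdiag ltnn.
Qed.

Lemma partial_column_base :
  exists x r g g', partial_column 0 x r g g'.
Proof.
have hsa := pos_sa h_pos.
have [|y ysa rhoy] := @sa_lift (cunit ord0 ord0 h - cdiag (fun j => (0 < j)%N) h).
  by rewrite starB star_cunit -(star_homS (cdiag_hom _)) hsa.
have [p [r [[psa rsa] pr rhop rhor _]]] :=
  @split_diag y ord0 h (prod_powers1 h) ysa rhoy.
have i0 i : (i <= 0)%N -> i = ord0 by rewrite leqn0 => /eqP i0; exact: val_inj.
(* Only the index 0 counts at this stage, so a constant column will do. *)
exists (fun=> p), r, h, h; split => //.
- exact: prod_powers1.
- exact: prod_powers1.
- by move=> i j /i0 -> /i0 ->; rewrite eqxx.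
- by move=> _ _; rewrite -psa -rsa -starM pr star0.
- by move=> i /i0 ->; rewrite rhop; congr cunit; apply: val_inj; rewrite /= inordK.
Qed.

(** Compressing [y'] by [r] makes the new [p] and [r'] annihilate the old entries. Right
    multiplication by [y ** p] moves those entries from column [k] to column [k.+1] and keeps their
    orthogonality and their common modulus, which the new entry [q] must share. *)
Lemma partial_column_step (k : nat) x r g g' : (k < n)%N -> partial_column k x r g g' ->
  exists x' r' g1 g1', partial_column k.+1 x' r' g1 g1'.
Proof.
move=> kn [gpw g'pw orth nrm rsa rx rhox rhor].
have hsa := pos_sa h_pos.
pose k0 : 'I_n.+1 := inord k; pose k1 : 'I_n.+1 := inord k.+1.
have k0E : k0 = k :> nat by rewrite inordK// ltnW.
have k1E : k1 = k.+1 :> nat by rewrite inordK.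
have kk1 : (k < k1)%N by rewrite k1E.
have [|y' y'sa rhoy'] := @sa_lift (cunit k1 k1 h - cdiag (fun j => (k1 < j)%N) h).
  by rewrite starB star_cunit -(star_homS (cdiag_hom _)) hsa.
have [y rhoy] := rho_surj (cunit k0 k1 h).
(* [h] compressed on both sides by the coefficient [g'] of [rho r]. *)
pose g2 := g' ** h ** g'.
have g2pw : pw g2 by do 2?apply: prod_powersM => //; exact: prod_powers1.
have tail_sub a b : cdiag (fun j => (k < j)%N) a ** cdiag (fun j => (k1 < j)%N) b =
    cdiag (fun j => (k1 < j)%N) (a ** b).
  rewrite {2}/cdiag (big_morph (smul _) (fun x y => smulDr _ x y) (smul0r _)).
  by apply: eq_bigr => i; rewrite k1E => ki; rewrite cdiag_cunit (ltnW ki).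
have tail_sub' a b : cdiag (fun j => (k1 < j)%N) a ** cdiag (fun j => (k < j)%N) b =
    cdiag (fun j => (k1 < j)%N) (a ** b).
  rewrite {1}/cdiag (big_morph (smul^~ _) (fun x y => smulDl x y _) (smul0l _)).
  by apply: eq_bigr => i; rewrite k1E => ki; rewrite cunit_cdiag (ltnW ki).
have zsa : star (r ** y' ** r) = r ** y' ** r by rewrite !starM rsa y'sa smulA.
have [|p [r' [[psa r'sa] pr' rhop rhor' z0]]] := @split_diag (r ** y' ** r) k1 g2 g2pw zsa.
  rewrite !(star_homM hrho) rhor rhoy' smulBr smulBl cdiag_cunit kk1.
  by rewrite cunit_cdiag kk1 tail_sub tail_sub'.
have px i : (i <= k)%N -> p ** x i = 0 /\ r' ** x i = 0.
  by move=> ik; apply: z0; rewrite -!smulA rx// !smul0r.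
pose z := x k0 ** y ** p; pose w := g ** h ** g2.
have wpw : pw w by do 2?apply: prod_powersM => //; exact: prod_powers1.
have wpos := prod_powers_pos hN h_pos wpw; have wsa := pos_sa wpos.
have rhox' i : (i <= k)%N -> rho (x i ** y ** p) = cunit i k1 w.
  by move=> ik; rewrite !(star_homM hrho) rhox// rhoy rhop !cunitMM.
have k0k : (k0 <= k)%N by rewrite k0E.
(* [rho z] is [w] in position [(k0, k1)], whereas its absolute value is [w] in position [(k1, k1)].
   So the absolute value of [z] moves to the new row without changing [star z ** z]. *)
have [||q [qsa qq rhoq q0]] := abs_lift hNB hNC hrho (z := z) (w := cunit k1 k1 w).
- exact: (star_hom_pos (cunit_hom k1)).
- by rewrite rhox'// star_cunit !cunitMM wsa.
have qx i : (i <= k)%N -> q ** (x i ** y ** p) = 0.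
  move=> ik; apply: q0; rewrite /z -!smulA (smulA p) (px i ik).1.
  by rewrite smul0l !smul0r.
have qr' : q ** r' = 0 by apply: q0; rewrite /z -smulA pr' smul0r.
have le1 i : (i <= k.+1)%N -> (i <= k)%N = false -> i = k1.
  by move=> ik1 ik; apply: val_inj; rewrite /= k1E; apply/eqP; rewrite eqn_leq ik1 ltnNge ik.
have xx i j : (i <= k)%N -> (j <= k)%N ->
    star (x i ** y ** p) ** (x j ** y ** p) =
    star p ** star y ** (star (x i) ** x j) ** y ** p.
  by move=> _ _; rewrite !starM !smulA.
(* The value [q] is meant for [k1]; at later indices it is a filler. *)
exists (fun i => if (i <= k)%N then x i ** y ** p else q), r', w, g2; split => //.
- move=> i j i1 j1; case: ifP => ik; case: ifP => jk ij.
  + by rewrite xx// orth// smul0r !smul0l.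
  + by rewrite -qsa -starM qx// star0.
  + by rewrite qsa qx.
  + by rewrite (le1 i)// (le1 j) ?eqxx in ij.
- have nz i : (i <= k)%N -> star (x i ** y ** p) ** (x i ** y ** p) = star z ** z.
    by move=> ik; rewrite !xx// (nrm i k0).
  move=> i j _ _; case: ifP => ik; case: ifP => jk; rewrite ?nz//.
  + by rewrite qsa qq.
  + by rewrite qsa qq.
- move=> i _; case: ifP => ik; last by rewrite -r'sa -qsa -starM qr' star0.
  by rewrite !smulA (px i ik).2 !smul0l.
- by move=> i i1; case: ifP => ik; [exact: rhox'|rewrite rhoq (le1 i)].
- by rewrite rhor' k1E.
Qed.

Lemma column_lift : exists (x : 'I_n.+1 -> B) (g : A), [/\ pw g,
  forall i j, i != j -> star (x i) ** x j = 0,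
  forall i j, star (x i) ** x i = star (x j) ** x j &
  forall i, rho (x i) = cunit i ord_max g].
Proof.
have [x [r [g [g' H]]]] : exists x r g g', partial_column n x r g g'.
  suff : forall k : nat, (k <= n)%N -> exists x r g g', partial_column k x r g g'.
    by move=> /(_ n (leqnn n)).
  elim=> [_|k IH kn]; first exact: partial_column_base.
  have [x [r [g [g']]]] := IH (ltnW kn); exact: partial_column_step.
have le i : (i <= n)%N by rewrite -ltnS.
case: H => gpw _ orth nrm _ _ rhox _; exists x, g; split => //.
- by move=> i j; exact: orth.
- by move=> i j; exact: nrm.
- by move=> i; rewrite rhox//; congr cunit; apply: val_inj; rewrite /= inordK.
Qed.

End MatrixUnitLifting.

(** * The algebra of lifted corners *)

Record star_closed (R : realType) (V : starAlgType R) (S : set V) : Prop := {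
  star_closed0 : S 0;
  star_closedZD : forall (c : R[i]) x y, S x -> S y -> S (c *: x + y);
  star_closedM : forall x y, S x -> S y -> S (x ** y);
  star_closedS : forall x, S x -> S (star x)
}.

(** The closure proof is a parameter of the type, so that the operations can be canonical;
    membership is a boolean, so that [sub_val] is injective. *)
Record star_sub (R : realType) (V : starAlgType R) (S : set V) (hS : star_closed S) :=
  StarSub { sub_val : V; sub_valP : `[< S sub_val >] }.

Arguments sub_val {R V S hS} s.

Section StarSub.
Variables (R : realType) (V : starAlgType R) (S : set V) (hS : star_closed S).
Local Notation U := (star_sub hS).
Implicit Types u v : U.

HB.instance Definition _ := [isSub for @sub_val R V S hS].
HB.instance Definition _ := [Choice of U by <:].

Definition sub_mk x (Sx : S x) : U := @StarSub R V S hS x (asboolT Sx).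

Lemma sub_in u : S (sub_val u). Proof. by apply/asboolP; exact: sub_valP. Qed.

Lemma star_closedD x y : S x -> S y -> S (x + y).
Proof. by rewrite -{2}[x]scale1r; exact: star_closedZD. Qed.

Lemma star_closedZ (c : R[i]) x : S x -> S (c *: x).
Proof.
by move=> Sx; rewrite -[_ *: _]addr0; apply: star_closedZD => //; exact: star_closed0.
Qed.

Lemma star_closedN x : S x -> S (- x).
Proof. by rewrite -scaleN1r; exact: star_closedZ. Qed.

Definition sub_zero : U := sub_mk (star_closed0 hS).
Definition sub_add u v : U := sub_mk (star_closedD (sub_in u) (sub_in v)).
Definition sub_opp u : U := sub_mk (star_closedN (sub_in u)).
Definition sub_scale (c : R[i]) u : U := sub_mk (star_closedZ c (sub_in u)).
Definition sub_mul u v : U := sub_mk (star_closedM hS (sub_in u) (sub_in v)).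
Definition sub_star u : U := sub_mk (star_closedS hS (sub_in u)).

Lemma sub_addA : associative sub_add.
Proof. by move=> u v w; apply: val_inj; exact: addrA. Qed.

Lemma sub_addC : commutative sub_add.
Proof. by move=> u v; apply: val_inj; exact: addrC. Qed.

Lemma sub_add0 : left_id sub_zero sub_add.
Proof. by move=> u; apply: val_inj; exact: add0r. Qed.

Lemma sub_addN : left_inverse sub_zero sub_opp sub_add.
Proof. by move=> u; apply: val_inj; exact: addNr. Qed.

HB.instance Definition _ :=
  GRing.isZmodule.Build U sub_addA sub_addC sub_add0 sub_addN.

Lemma sub_scaleA c1 c2 u : sub_scale c1 (sub_scale c2 u) = sub_scale (c1 * c2) u.
Proof. by apply: val_inj; exact: scalerA. Qed.

Lemma sub_scale1 : left_id 1 sub_scale.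
Proof. by move=> u; apply: val_inj; exact: scale1r. Qed.

Lemma sub_scaleDr : right_distributive sub_scale +%R.
Proof. by move=> c u v; apply: val_inj; exact: scalerDr. Qed.

Lemma sub_scaleDl u : {morph sub_scale^~ u : c1 c2 / c1 + c2}.
Proof. by move=> c1 c2; apply: val_inj; exact: scalerDl. Qed.

HB.instance Definition _ := GRing.Zmodule_isLmodule.Build R[i] U
  sub_scaleA sub_scale1 sub_scaleDr sub_scaleDl.

Lemma sub_mulA : associative sub_mul.
Proof. by move=> u v w; apply: val_inj; exact: smulA. Qed.

Lemma sub_mulDl : left_distributive sub_mul +%R.
Proof. by move=> u v w; apply: val_inj; exact: smulDl. Qed.

Lemma sub_mulDr : right_distributive sub_mul +%R.
Proof. by move=> u v w; apply: val_inj; exact: smulDr. Qed.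

Lemma sub_mulZl (c : R[i]) u v : sub_mul (c *: u) v = c *: sub_mul u v.
Proof. by apply: val_inj; exact: smulZl. Qed.

Lemma sub_mulZr (c : R[i]) u v : sub_mul u (c *: v) = c *: sub_mul u v.
Proof. by apply: val_inj; exact: smulZr. Qed.

Lemma sub_starK : involutive sub_star.
Proof. by move=> u; apply: val_inj; exact: starK. Qed.

Lemma sub_starD : {morph sub_star : u v / u + v}.
Proof. by move=> u v; apply: val_inj; exact: starD. Qed.

Lemma sub_starZ (c : R[i]) u : sub_star (c *: u) = (c^*)%R *: sub_star u.
Proof. by apply: val_inj; exact: starZ. Qed.

Lemma sub_starM u v : sub_star (sub_mul u v) = sub_mul (sub_star v) (sub_star u).
Proof. by apply: val_inj; exact: starM. Qed.

HB.instance Definition _ := Lmodule_isStarAlgebra.Build R U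
  sub_mulA sub_mulDl sub_mulDr sub_mulZl sub_mulZr
  sub_starK sub_starD sub_starZ sub_starM.

End StarSub.

(* Pairs [(T, a)] where [T] stands for the matrix [(x_i b x_j^* )_ij] with
   [x_i^* x_j = delta_ij K]: since [(x_i b x_l^* ) (x_l b' x_j^* )] does not
   depend on [l], the product only uses the first column and the first row. *)
Definition link (R : realType) (n : nat) (B A : starAlgType R) : Type :=
  (star_mx n.+1 B * A)%type.

Section Link.
Variables (R : realType) (n : nat) (B A : starAlgType R).
Local Notation L := (link n B A).
Local Notation MB := (star_mx n.+1 B).
Implicit Types u v w : L.

HB.instance Definition _ := GRing.Lmodule.copy L (MB * A)%type.

(** The laws hold for arbitrary matrices, both bracketings of a triple product being
    [u_i0 v_00 w_0j]; no relation between the entries has to be imposed first. *)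
Definition link_mul u v : L :=
  ((\matrix_(i, j) ((u.1 : 'M[B]_n.+1) i ord0 ** (v.1 : 'M[B]_n.+1) ord0 j) : MB),
   u.2 ** v.2).
Definition link_star u : L := (star u.1, star u.2).

Lemma link_eq u v : u.1 = v.1 -> u.2 = v.2 -> u = v.
Proof. by case: u v => [? ?] [? ?] /= -> ->. Qed.

Lemma link_mulA : associative link_mul.
Proof.
move=> u v w; apply: link_eq; last exact: smulA.
by apply/matrixP => i j; rewrite !mxE smulA.
Qed.

Lemma link_mulDl : left_distributive link_mul +%R.
Proof.
move=> u v w; apply: link_eq; last exact: smulDl.
by apply/matrixP => i j; rewrite !mxE smulDl.
Qed.

Lemma link_mulDr : right_distributive link_mul +%R.
Proof.
move=> u v w; apply: link_eq; last exact: smulDr.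
by apply/matrixP => i j; rewrite !mxE smulDr.
Qed.

Lemma link_mulZl (c : R[i]) u v : link_mul (c *: u) v = c *: link_mul u v.
Proof.
apply: link_eq; last exact: smulZl.
by apply/matrixP => i j; rewrite !mxE smulZl.
Qed.

Lemma link_mulZr (c : R[i]) u v : link_mul u (c *: v) = c *: link_mul u v.
Proof.
apply: link_eq; last exact: smulZr.
by apply/matrixP => i j; rewrite !mxE smulZr.
Qed.

Lemma link_starK : involutive link_star.
Proof. by move=> u; apply: link_eq; exact: starK. Qed.

Lemma link_starD : {morph link_star : u v / u + v}.
Proof. by move=> u v; apply: link_eq; exact: starD. Qed.

Lemma link_starZ (c : R[i]) u : link_star (c *: u) = (c^*)%R *: link_star u.
Proof. by apply: link_eq; exact: starZ. Qed.

Lemma link_starM u v : link_star (link_mul u v) = link_mul (link_star v) (link_star u).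
Proof.
apply: link_eq; last exact: starM.
by apply/matrixP => i j; rewrite !mxE starM.
Qed.

HB.instance Definition _ := Lmodule_isStarAlgebra.Build R L
  link_mulA link_mulDl link_mulDr link_mulZl link_mulZr
  link_starK link_starD link_starZ link_starM.

End Link.

(** * The C*-algebra of linked pairs and the homomorphisms assembled from it *)

Section LinkAlgebra.
Variables (R : realType) (n : nat) (A B C : starAlgType R).
Variables (N : A -> R) (NB : B -> R) (NC : C -> R).
Hypotheses (hN : cstar_norm N) (hNB : cstar_norm NB) (hNC : cstar_norm NC).
Variables (phi : star_mx n.+1 A -> C) (rho : B -> C).
Hypotheses (hphi : star_hom phi) (hrho : star_hom rho).
Variable x : 'I_n.+1 -> B.
Hypothesis x_orth : forall i j, i != j -> star (x i) ** x j = 0.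
Hypothesis x_norm : forall i j, star (x i) ** x i = star (x j) ** x j.
Local Notation L := (link n B A).
Local Notation c := (cunit phi).
Implicit Types (u v : L) (i j k l : 'I_n.+1).

Let K := star (x ord0) ** x ord0.

Let xx i j : star (x i) ** x j = if i == j then K else 0.
Proof. by case: eqVneq => [<-|/x_orth//]; exact: x_norm. Qed.

Definition entry u i j : B := (u.1 : 'M[B]_n.+1) i j.

(** One sequence [b] serves all positions simultaneously; this ties every entry to the one at
    [(ord0, ord0)], which runs through the corner. Limits are built in so that the set is
    complete. *)
Definition link_set : set L := [set u |
  (exists b : nat -> B, forall i j,
    cvg_for NB (fun m => x i ** b m ** star (x j)) (entry u i j)) /\
  forall i j, rho (entry u i j) = c i j u.2].

Lemma link_set_closed : star_closed link_set.
Proof.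
split.
- split; last first.
    by move=> i j; rewrite /entry mxE (star_hom0 hrho) /= (cunit0 hphi).
  exists (fun=> 0) => i j; rewrite /entry mxE smul0r smul0l.
  exact: (cvg_for_cst hNB).
- move=> a u v [[b bu] ru] [[d dv] rv]; split.
    exists (fun m => a *: b m + d m) => i j; rewrite /entry !mxE.
    rewrite (_ : (fun _ => _) = fun m => a *: (x i ** b m ** star (x j)) +
        x i ** d m ** star (x j)).
      by apply: (cvg_forD hNB); [apply: (cvg_forZ hNB); exact: bu|exact: dv].
    by apply/funext => m; rewrite smulDr smulDl smulZr smulZl.
  move=> i j; rewrite /entry !mxE (star_homD hrho) (star_homZ hrho).
  by rewrite -/(entry u i j) -/(entry v i j) ru rv (cunitD hphi) (cunitZ hphi).
- move=> u v [[b bu] ru] [[d dv] rv]; split.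
    exists (fun m => b m ** K ** d m) => i j; rewrite /entry !mxE.
    rewrite (_ : (fun _ => _) = fun m => (x i ** b m ** star (x ord0)) **
        (x ord0 ** d m ** star (x j))).
      by apply: (cvg_forM hNB); [exact: bu|exact: dv].
    by apply/funext => m; rewrite /K !smulA.
  move=> i j; rewrite /entry !mxE (star_homM hrho) -/(entry u i ord0) -/(entry v ord0 j) ru rv.
  by rewrite (cunitMM hphi).
- move=> u [[b bu] ru]; split.
    exists (fun m => star (b m)) => i j; rewrite /entry !mxE.
    rewrite (_ : (fun _ => _) = fun m => star (x j ** b m ** star (x i))).
      by apply: (cvg_for_star hNB); exact: bu.
    by apply/funext => m; rewrite !starM starK smulA.
  by move=> i j; rewrite /entry !mxE (star_homS hrho) -/(entry u j i) ru (star_cunit hphi).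
Qed.

Local Notation S := (star_sub link_set_closed).

(** The norm of [x i ** y] depends on [x i] only through [star (x i) ** x i], which is the same for
    all [i]; adjoints give the same on the right. *)
Lemma entry_norm u i j : link_set u -> NB (entry u i j) = NB (entry u ord0 ord0).
Proof.
move=> [[b bu] _].
have left_swap (y : B) i' j' : NB (x i' ** y) = NB (x j' ** y).
  apply/eqP; rewrite -(@eqrXn2 _ 2)// ?(cnorm_ge0 hNB)//; apply/eqP.
  rewrite -!(cnorm_cstar hNB) !starM -!smulA !(smulA (star (x _))).
  by rewrite (x_norm i' j').
have swap m i' j' : NB (x i' ** b m ** star (x j')) =
    NB (x ord0 ** b m ** star (x ord0)).
  rewrite -smulA (left_swap _ i' ord0) smulA -(cnorm_star hNB).
  rewrite starM starK (left_swap _ j' ord0) -(cnorm_star hNB).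
  by rewrite starM starK.
have nlim i' j' : NB (x i' ** b m ** star (x j')) @[m --> \oo] --> NB (entry u i' j').
  exact: (cnorm_cvg hNB).
have nE : (fun m => NB (x i ** b m ** star (x j))) =
    fun m => NB (x ord0 ** b m ** star (x ord0)) by apply/funext => m; exact: swap.
have := nlim i j; rewrite nE => H.
exact: (cvg_unique _ H (nlim ord0 ord0)).
Qed.

(** In the approximating products the middle factor is [star (x j) ** x k], so orthogonality and the
    common value [K] survive in the limit. *)
Lemma entry_mul u v i j k l : link_set u -> link_set v ->
  entry u i j ** entry v k l = if j == k then entry u i ord0 ** entry v ord0 l else 0.
Proof.
move=> [[b bu] _] [[d dv] _].
have mulE j' k' : cvg_for NB (fun m => x i ** b m ** (if j' == k' then K else 0)
    ** (d m ** star (x l))) (entry u i j' ** entry v k' l).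
  rewrite (_ : (fun _ => _) = fun m => (x i ** b m ** star (x j')) **
      (x k' ** d m ** star (x l))).
    by apply: (cvg_forM hNB); [exact: bu|exact: dv].
  by apply/funext => m; rewrite -xx !smulA.
case: eqVneq => [<-|/negPf jk].
  have := mulE j j; have := mulE ord0 ord0; rewrite !eqxx => H0 Hj.
  exact: (cvg_for_unique hNB Hj H0).
apply: (cvg_for_unique hNB (mulE j k)); rewrite jk.
by under eq_fun do rewrite smul0r smul0l; exact: (cvg_for_cst hNB).
Qed.

(** By [entry_norm] this one entry controls all the others, and on it the product and the star are
    those of [B]. *)
Definition link_norm (s : S) : R :=
  Num.max (NB (entry (sub_val s) ord0 ord0)) (N (sub_val s).2).

Lemma link_norm_cstar : cstar_norm link_norm.
Proof.
have n0 s : 0 <= link_norm s by rewrite le_max (cnorm_ge0 hN) orbT.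
have le1 (s : S) i j : NB (entry (sub_val s) i j) <= link_norm s.
  by rewrite (entry_norm _ _ (sub_in s)) le_max lexx.
have le2 (s : S) : N (sub_val s).2 <= link_norm s by rewrite le_max lexx orbT.
split.
- move=> s t; rewrite ge_max; apply/andP; split.
    rewrite /entry mxE (le_trans (cnorm_triangle hNB _ _))//.
    by rewrite lerD//; exact: (le1 _ ord0 ord0).
  by rewrite (le_trans (cnorm_triangle hN _ _))// lerD.
- move=> a s; rewrite /link_norm /entry mxE (cnormZ hNB) (cnormZ hN).
  by rewrite maxr_pMr// absC_ge0.
- move=> s s0; apply: val_inj; apply: link_eq.
    apply/matrixP => i j; rewrite mxE; apply: (cnorm_le0 hNB).
    by rewrite -s0; exact: (le1 _ i j).
  by apply: (cnorm_le0 hN); rewrite -s0; exact: le2.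
- move=> s t; rewrite ge_max; apply/andP; split.
    rewrite /entry mxE (le_trans (cnorm_submul hNB _ _))//.
    by rewrite ler_pM ?(cnorm_ge0 hNB)//; exact: (le1 _ ord0 ord0).
  by rewrite (le_trans (cnorm_submul hN _ _))// ler_pM ?(cnorm_ge0 hN).
- move=> s; rewrite /link_norm /entry !mxE (cnorm_cstar hNB) (cnorm_cstar hN).
  rewrite !maxEle ler_pXn2r ?nnegrE ?(cnorm_ge0 hN) ?(cnorm_ge0 hNB)//.
  by case: ifP.
move=> s sc.
have [a sa] : exists a, cvg_for N (fun m => (sub_val (s m)).2) a.
  apply: (cnorm_complete hN) => e /sc[k Hk]; exists k => p q kp kq.
  by rewrite (le_lt_trans _ (Hk p q kp kq))//; exact: (le2 (s p - s q)).
have /choice[T HT] : forall ij : 'I_n.+1 * 'I_n.+1,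
    exists b, cvg_for NB (fun m => entry (sub_val (s m)) ij.1 ij.2) b.
  move=> [i j]; apply: (cnorm_complete hNB) => e /sc[k Hk]; exists k => p q kp kq.
  rewrite (le_lt_trans _ (Hk p q kp kq))//=.
  by have := le1 (s p - s q) i j; rewrite /entry !mxE.
pose u : L := ((\matrix_(i, j) T (i, j) : star_mx n.+1 B), a).
have entE i j : entry u i j = T (i, j) by rewrite /entry mxE.
have Su : link_set u.
  split; last first.
    move=> i j; rewrite entE.
    apply: (cvg_for_unique hNC (star_hom_cvg hNB hNC hrho (HT (i, j)))) => /=.
    apply: (cvg_for_bounded_by hNC _ sa) => m.
    by rewrite (sub_in (s m)).2 -(cunitB hphi); exact: (cunit_norm hN hNC hphi).
  (* Diagonal choice: a term of the sequence close to [u] in all positions, then a term of its own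
     approximating sequence, each with half of the error [m.+1%:R^-1]. *)
  have /choice[b Hb] : forall m : nat, exists b, forall i j,
      NB (x i ** b ** star (x j) - entry u i j) <= m.+1%:R^-1.
    move=> m; have e0 : 0 < m.+1%:R^-1 / 2 :> R by rewrite divr_gt0.
    have [p Hp] : exists p, forall ij : 'I_n.+1 * 'I_n.+1,
        NB (entry (sub_val (s p)) ij.1 ij.2 - T ij) < m.+1%:R^-1 / 2.
      have /choice[f Hf] : forall ij : 'I_n.+1 * 'I_n.+1, exists p, forall k : nat,
          (p <= k)%N -> NB (entry (sub_val (s k)) ij.1 ij.2 - T ij) < m.+1%:R^-1 / 2.
        by move=> ij; exact: ((cvg_forP (cnorm_ge0 hNB) _ _).1 (HT ij) _ e0).
      exists (\max_ij f ij)%N => ij; apply: Hf; exact: leq_bigmax.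
    have [[d Hd] _] := sub_in (s p).
    have [q Hq] : exists q, forall ij : 'I_n.+1 * 'I_n.+1,
        NB (x ij.1 ** d q ** star (x ij.2) - entry (sub_val (s p)) ij.1 ij.2)
          < m.+1%:R^-1 / 2.
      have /choice[f Hf] : forall ij : 'I_n.+1 * 'I_n.+1, exists q, forall k : nat,
          (q <= k)%N -> NB (x ij.1 ** d k ** star (x ij.2) -
            entry (sub_val (s p)) ij.1 ij.2) < m.+1%:R^-1 / 2.
        by move=> [i j]; exact: ((cvg_forP (cnorm_ge0 hNB) _ _).1 (Hd i j) _ e0).
      exists (\max_ij f ij)%N => ij; apply: Hf; exact: leq_bigmax.
    exists (d q) => i j; rewrite entE.
    rewrite (le_trans (cnorm_distT hNB (entry (sub_val (s p)) i j) _ _))//.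
    by rewrite [leRHS]splitr lerD// ltW//; [exact: (Hq (i, j))|exact: (Hp (i, j))].
  exists b => i j; apply: (cvg_for_bounded_by hNB (v := fun m => m.+1%:R^-1)) => //.
  exact: cvg_harmonic.
exists (sub_mk link_set_closed Su).
apply: (@squeeze_cvgr _ _ _ _ (fun=> 0) (fun m =>
  NB (entry (sub_val (s m)) ord0 ord0 - T (ord0, ord0)) + N ((sub_val (s m)).2 - a))).
- near=> m; rewrite n0 /= ge_max; apply/andP; split.
    by rewrite /entry !mxE lerDl (cnorm_ge0 hN).
  by rewrite lerDr (cnorm_ge0 hNB).
- exact: cvg_cst.
- by rewrite -[X in _ --> X]addr0; apply: cvgD => //; exact: (HT (ord0, ord0)).
Unshelve. all: by end_near.
Qed.

Definition link_proj (s : S) : A := (sub_val s).2.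

Lemma link_proj_hom : star_hom link_proj. Proof. by []. Qed.

Lemma link_proj_surj (g : A) : star g = g -> right_dense N g ->
  (forall b, exists y, rho y = b) -> (forall i, rho (x i) = c i ord_max g) ->
  forall a, exists s, link_proj s = a.
Proof.
move=> gsa gd rho_surj rhox.
apply: (star_hom_dense_surj link_norm_cstar hN link_proj_hom) => a t t0.
have [b Hb] := two_sided_dense hN gsa gd a t0.
(* Between [x i] and [star (x j)] this lift maps to [g ** b ** g] in position [(i, j)], and such
   coefficients are dense. *)
have [y rhoy] := rho_surj (c ord_max ord_max b).
pose u : L := ((\matrix_(i, j) (x i ** y ** star (x j)) : star_mx n.+1 B), g ** b ** g).
suff Su : link_set u by exists (sub_mk link_set_closed Su).
split; last first.
  move=> i j; rewrite /entry mxE !(star_homM hrho) (star_homS hrho) !rhox rhoy.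
  by rewrite (star_cunit hphi) gsa !(cunitMM hphi).
by exists (fun=> y) => i j; rewrite /entry mxE; exact: (cvg_for_cst hNB).
Qed.

Lemma sub_val_sum (I : Type) (r : seq I) (P : pred I) (F : I -> S) i j :
  entry (sub_val (\sum_(k <- r | P k) F k)) i j =
  \sum_(k <- r | P k) entry (sub_val (F k)) i j.
Proof.
rewrite (big_morph (fun s : S => entry (sub_val s) i j) (id1 := 0) (op1 := +%R))//.
  by move=> s t; rewrite /entry mxE.
by rewrite /entry mxE.
Qed.

(** The composite of [psi], applied entrywise, with the map from matrices over the corner to [B];
    matrices over the corner are never formed. *)
Definition assemble (psi : A -> S) (T : star_mx n.+1 A) : B :=
  \sum_i \sum_j entry (sub_val (psi ((T : 'M[A]_n.+1) i j))) i j.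

Lemma assemble_hom psi : star_hom psi -> star_hom (assemble psi).
Proof.
move=> hpsi; split.
- move=> a T U; rewrite /assemble scaler_sumr -big_split; apply: eq_bigr => i _ /=.
  rewrite scaler_sumr -big_split; apply: eq_bigr => j _ /=.
  by rewrite !mxE (star_homD hpsi) (star_homZ hpsi) /entry !mxE.
- move=> T U; rewrite /assemble smul_suml; apply: eq_bigr => i _.
  rewrite smul_suml.
  have entM j : entry (sub_val (psi ((T ** U : star_mx n.+1 A) i j))) i j =
      \sum_k entry (sub_val (psi (T i k))) i ord0 **
        entry (sub_val (psi (U k j))) ord0 j.
    rewrite mxE (star_hom_sum hpsi) sub_val_sum; apply: eq_bigr => k _.
    by rewrite (star_homM hpsi) /entry mxE.
  under eq_bigr do rewrite entM.
  rewrite exchange_big /=; apply: eq_bigr => k _.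
  rewrite smul_sumr [RHS](bigD1 k)//= smul_sumr [X in _ + X]big1 ?addr0 => [|l /negPf lk].
    by apply: eq_bigr => j _; rewrite [RHS](entry_mul _ _ _ _ (sub_in _) (sub_in _)) eqxx.
  rewrite smul_sumr big1// => j _; rewrite (entry_mul _ _ _ _ (sub_in _) (sub_in _)).
  by rewrite eq_sym lk.
- move=> T; rewrite /assemble star_sum exchange_big; apply: eq_bigr => i _ /=.
  rewrite star_sum; apply: eq_bigr => j _.
  by rewrite !mxE (star_homS hpsi) /entry !mxE.
Qed.

Lemma rho_assemble psi T :
  rho (assemble psi T) = \sum_i \sum_j c i j (link_proj (psi ((T : 'M[A]_n.+1) i j))).
Proof.
rewrite (star_hom_sum hrho); apply: eq_bigr => i _.
rewrite (star_hom_sum hrho); apply: eq_bigr => j _.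
by have [_ ->] := sub_in (psi ((T : 'M[A]_n.+1) i j)).
Qed.

End LinkAlgebra.

(** * Approximate lifting for matrix algebras *)

Lemma id_star_hom (R : realType) (A : starAlgType R) : star_hom (@id A).
Proof. by []. Qed.

Theorem theorem6p1 (R : realType) (n : nat) (n_gt0 : (0 < n)%N)
    (A : starAlgType R) (N : A -> R)
    (A_cstar : cstar_norm N) (A_separable : separable_for N)
    (A_wproj : weakly_projective N) :
  weakly_projective (A := star_mx n A) (star_mx_norm (n := n) N).
Proof.
split; [exact: star_mx_norm_cstar|exact: star_mx_norm_separable|].
(* A successor size provides [ord0], the base point of the linked pairs, and [ord_max], the column
   that is lifted. *)
case: n n_gt0 => // n _ B C NB NC hNB hNC phi rho hphi hrho rho_surj.
have [h [h_pos h_dense]] := exists_strictly_positive A_cstar A_separable.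
have [x [g [gpw x_orth x_norm rhox]]] :=
  column_lift A_cstar hNB hNC hphi hrho rho_surj h_pos.
have gsa := pos_sa (prod_powers_pos A_cstar h_pos gpw).
have gdense := prod_powers_dense A_cstar h_dense gpw.
have link_cstar := link_norm_cstar A_cstar hNB hNC hphi hrho x_norm.
have proj_surj := link_proj_surj A_cstar hNB hNC hphi hrho x_norm gsa gdense rho_surj rhox.
have [_ _ lift] := A_wproj.
have [psi [psi_hom psi_cvg]] := lift _ _ _ _ link_cstar A_cstar _ _
  (id_star_hom A) (link_proj_hom hNB hphi hrho x) proj_surj.
exists (fun k => assemble (psi k)); split=> [k|T].
  exact: assemble_hom.
apply: (cvg_for_bounded_by hNC (v := fun k => \sum_i \sum_j
    N (link_proj (psi k ((T : 'M[A]_n.+1) i j)) - T i j))).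
  move=> k; rewrite rho_assemble {2}(mx_unit_sum T) (star_hom_sum hphi) -sumrB.
  rewrite (le_trans (cnorm_sum hNC _ _ _))//; apply: ler_sum => i _.
  rewrite (star_hom_sum hphi) -sumrB.
  rewrite (le_trans (cnorm_sum hNC _ _ _))//; apply: ler_sum => j _.
  rewrite -/(cunit phi i j (T i j)) -(cunitB hphi).
  exact: (cunit_norm A_cstar hNC hphi).
by do 2!apply: cvg_sum0 => ?; exact: psi_cvg.
Qed.
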